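(* For any $k\geq 1$, the procedure $[\![Y_{\overline{k+1}}]\!]\in{\mathsf{SP}}^0((\overline{k+1}\rightarrow\overline{k+1})\rightarrow\overline{k+1})$ is not ${\mathrm{PCF}}^\Omega_k$-denotable, i.e.\ there is no closed ${\mathrm{PCF}}^\Omega_k$ term $M$ with $[\![M]\!]=[\![Y_{\overline{k+1}}]\!]$; hence neither is $[\![Y_{\mathbb{N}\rightarrow\overline{k+1}}]\!]$.
   Context: Types: $\sigma::=\mathbb{N}\mid\sigma\rightarrow\sigma$; $\sigma_0,\ldots,\sigma_{r-1}\rightarrow\mathbb{N}$ abbreviates $\sigma_0\rightarrow\cdots\rightarrow\sigma_{r-1}\rightarrow\mathbb{N}$; ${\mathrm{lv}}(\mathbb{N})=0$, ${\mathrm{lv}}(\sigma\rightarrow\tau)=\max({\mathrm{lv}}(\sigma)+1,{\mathrm{lv}}(\tau))$; pure types $\overline{0}=\mathbb{N}$, $\overline{k+1}=\overline{k}\rightarrow\mathbb{N}$. ${\mathrm{PCF}}^\Omega$ is the simply typed $\lambda$-calculus over $\mathbb{N}$ with constants $\underline{n}$, $\mathit{suc},\mathit{pre}$, $\mathit{ifzero}$, $Y_\sigma:(\sigma\rightarrow\sigma)\rightarrow\sigma$ for all $\sigma$, and $C_f:\mathbb{N}\rightarrow\mathbb{N}$ for each partial $f:\mathbb{N}\rightharpoonup\mathbb{N}$; ${\mathrm{PCF}}^\Omega_k$ admits $Y_\sigma$ only for ${\mathrm{lv}}(\sigma)\leq k$. Nested sequential procedures (NSPs) are the possibly infinite well-typed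 syntax trees generated coinductively by: procedures $p,q::=\lambda x_0\cdots x_{r-1}.e$ ($r\geq0$); expressions $d,e::=\bot\mid n\mid \mathtt{case}\ a\ \mathtt{of}\ (i\Rightarrow e_i\mid i\in\mathbb{N})$; applications $a::=x\,q_0\cdots q_{r-1}$ (variables carry types, $x\vec{q}$ requires $x:\sigma_0,\ldots,\sigma_{r-1}\rightarrow\mathbb{N}$ and $q_i:\sigma_i$), taken modulo $\alpha$-equivalence; ${\mathsf{SP}}^0(\sigma)$ is the set of closed procedures of type $\sigma$. Meta-terms additionally allow ground forms $P\vec{Q}$ and $\mathtt{case}\ G\ \mathtt{of}\ (\ldots)$ with $G$ any ground meta-term; they reduce by $(\lambda\vec{x}.E)\vec{Q}\rightsquigarrow E[\vec{x}\mapsto\vec{Q}]$, $\mathtt{case}\ \bot\ \mathtt{of}(\ldots)\rightsquigarrow\bot$, $\mathtt{case}\ n\ \mathtt{of}\ (i\Rightarrow E_i)\rightsquigarrow E_n$, $\mathtt{case}\ (\mathtt{case}\ G\ \mathtt{of}\ (i\Rightarrow E_i))\ \mathtt{of}\ (j\Rightarrow F_j)\rightsquigarrow \mathtt{case}\ G\ \mathtt{of}\ (i\Rightarrow\mathtt{case}\ E_i\ \mathtt{of}\ (j\Rightarrow F_j))$, applied in head position and recursively under $\lambda$, inside arguments of $x\vec{Q}$ and inside branches of $\mathtt{case}\ x\vec{Q}\ \mathtt{of}(\ldots)$; the value $\langle\!\langle T\rangle\!\rangle$ is the supremum (in the syntactic order with $\bot$ least) of all finite terms below some reduct of $T$. Application: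 $(\lambda x_0\cdots x_r.e)\cdot q=\lambda x_1\cdots x_r.\langle\!\langle e[x_0\mapsto q]\rangle\!\rangle$. For $x:\sigma_0,\ldots,\sigma_{r-1}\rightarrow\mathbb{N}$, $x^\eta=\lambda z_0\cdots z_{r-1}.\mathtt{case}\ x z_0^\eta\cdots z_{r-1}^\eta\ \mathtt{of}\ (i\Rightarrow i)$. The interpretation $[\![-]\!]$: $[\![x]\!]=x^\eta$, $[\![\underline n]\!]=\lambda.n$, $[\![\mathit{suc}]\!]=\lambda x.\mathtt{case}\ x\ \mathtt{of}\ (i\Rightarrow i+1)$, $[\![\mathit{pre}]\!]=\lambda x.\mathtt{case}\ x\ \mathtt{of}\ (0\Rightarrow0\mid i+1\Rightarrow i)$, $[\![\mathit{ifzero}]\!]=\lambda xyz.\mathtt{case}\ x\ \mathtt{of}\ (0\Rightarrow\mathtt{case}\ y\ \mathtt{of}(j\Rightarrow j)\mid i+1\Rightarrow\mathtt{case}\ z\ \mathtt{of}(j\Rightarrow j))$, $[\![C_f]\!]=\lambda x.\mathtt{case}\ x\ \mathtt{of}\ (i\Rightarrow f(i))$ ($f(i)=\bot$ if undefined), $[\![Y_\sigma]\!]=\lambda g.F_\sigma[g]$ where, for $\sigma=\sigma_0,\ldots,\sigma_{r-1}\rightarrow\mathbb{N}$, $F_\sigma[g]=\lambda x_0\cdots x_{r-1}.\mathtt{case}\ g(F_\sigma[g])x_0^\eta\cdots x_{r-1}^\eta\ \mathtt{of}\ (i\Rightarrow i)$ (corecursively), $[\![\lambda x.M]\!]=\lambda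 x.[\![M]\!]$, $[\![MN]\!]=[\![M]\!]\cdot[\![N]\!]$. *)

(* Defs.v *)
(* Nested sequential procedures (NSPs), PCF^Omega and the
   NSP interpretation [[-]], following the context of the paper.
   Variables are represented by de Bruijn indices (so alpha-equivalence is
   syntactic identity).  Convention: a binder block  lambda x0 ... x_{r-1}
   binds indices 0..r-1, with x_j having index r-1-j (so x_{r-1} is innermost,
   as for curried lambdas); variables of enclosing blocks are shifted by r. *)
From Stdlib Require Import List Arith ClassicalEpsilon.
Import ListNotations.

Inductive ty : Type := N | Arr (s t : ty).

Fixpoint lv (s : ty) : nat :=
  match s with N => 0 | Arr s t => Nat.max (lv s + 1) (lv t) end.

Fixpoint pure (k : nat) : ty :=
  match k with 0 => N | S k => Arr (pure k) N end.

Fixpoint argtys (s : ty) : list ty :=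
  match s with N => [] | Arr s t => s :: argtys t end.

Inductive term : Type :=
| Var (i : nat)
| Lam (s : ty) (M : term)
| App (M N : term)
| Numl (n : nat)
| Suc | Pre | Ifz
| Yc (s : ty)
| Cf (f : nat -> option nat).

Inductive has_type : list ty -> term -> ty -> Prop :=
| T_Var G i s : nth_error G i = Some s -> has_type G (Var i) s
| T_Lam G s t M : has_type (s :: G) M t -> has_type G (Lam s M) (Arr s t)
| T_App G s t M M' : has_type G M (Arr s t) -> has_type G M' s -> has_type G (App M M') t
| T_Num G n : has_type G (Numl n) N
| T_Suc G : has_type G Suc (Arr N N)
| T_Pre G : has_type G Pre (Arr N N)
| T_Ifz G : has_type G Ifz (Arr N (Arr N (Arr N N)))
| T_Y G s : has_type G (Yc s) (Arr (Arr s s) s)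
| T_C G f : has_type G (Cf f) (Arr N N).

Fixpoint Y_level_le (k : nat) (M : term) : Prop :=
  match M with
  | Yc s => lv s <= k
  | Lam _ M => Y_level_le k M
  | App M M' => Y_level_le k M /\ Y_level_le k M'
  | _ => True
  end.

Definition closed_PCFk (k : nat) (M : term) (s : ty) : Prop :=
  has_type [] M s /\ Y_level_le k M.

(* An argument list q_0 ... q_{r-1} is represented by (r, fun j => q_j);
   values at j >= r are irrelevant. *)
CoInductive mproc : Type :=
| MLam (ts : list ty) (E : mexpr)
with mexpr : Type :=
| MBot
| MNum (n : nat)
| MCase (G : mexpr) (br : nat -> mexpr)
| MVar (x : nat) (r : nat) (Qs : nat -> mproc)
| MApp (P : mproc) (r : nat) (Qs : nat -> mproc).

CoInductive is_nsp_p : mproc -> Prop :=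
| nsp_lam ts e : is_nsp_e e -> is_nsp_p (MLam ts e)
with is_nsp_e : mexpr -> Prop :=
| nsp_bot : is_nsp_e MBot
| nsp_num n : is_nsp_e (MNum n)
| nsp_case x r Qs br :
    (forall j, j < r -> is_nsp_p (Qs j)) -> (forall i, is_nsp_e (br i)) ->
    is_nsp_e (MCase (MVar x r Qs) br).

(* syntactic identity of (infinite) NSP trees = bisimilarity *)
CoInductive nsp_eq_p : mproc -> mproc -> Prop :=
| eqp_lam ts e e' : nsp_eq_e e e' -> nsp_eq_p (MLam ts e) (MLam ts e')
with nsp_eq_e : mexpr -> mexpr -> Prop :=
| eqe_bot : nsp_eq_e MBot MBot
| eqe_num n : nsp_eq_e (MNum n) (MNum n)
| eqe_case x r Qs Qs' br br' :
    (forall j, j < r -> nsp_eq_p (Qs j) (Qs' j)) ->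
    (forall i, nsp_eq_e (br i) (br' i)) ->
    nsp_eq_e (MCase (MVar x r Qs) br) (MCase (MVar x r Qs') br').

Definition uren (r : nat) (rho : nat -> nat) (i : nat) : nat :=
  if i <? r then i else rho (i - r) + r.

CoFixpoint ren_p (rho : nat -> nat) (P : mproc) : mproc :=
  match P with MLam ts e => MLam ts (ren_e (uren (length ts) rho) e) end
with ren_e (rho : nat -> nat) (E : mexpr) : mexpr :=
  match E with
  | MBot => MBot
  | MNum n => MNum n
  | MCase G br => MCase (ren_e rho G) (fun i => ren_e rho (br i))
  | MVar x r Qs => MVar (rho x) r (fun j => ren_p rho (Qs j))
  | MApp P r Qs => MApp (ren_p rho P) r (fun j => ren_p rho (Qs j))
  end.

(* a substitution maps each variable to a variable or to a procedure
   (both living in the target context) *)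
Definition env := nat -> (nat + mproc)%type.

Definition usub (r : nat) (sg : env) : env :=
  fun i => if i <? r then inl i else
    match sg (i - r) with
    | inl j => inl (j + r)
    | inr Q => inr (ren_p (fun j => j + r) Q)
    end.

CoFixpoint subst_p (sg : env) (P : mproc) : mproc :=
  match P with MLam ts e => MLam ts (subst_e (usub (length ts) sg) e) end
with subst_e (sg : env) (E : mexpr) : mexpr :=
  match E with
  | MBot => MBot
  | MNum n => MNum n
  | MCase G br => MCase (subst_e sg G) (fun i => subst_e sg (br i))
  | MVar x r Qs =>
      match sg x with
      | inl y => MVar y r (fun j => subst_p sg (Qs j))
      | inr Q => MApp Q r (fun j => subst_p sg (Qs j))
      end
  | MApp P r Qs => MApp (subst_p sg P) r (fun j => subst_p sg (Qs j))
  end.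

(* E[x_0 |-> Q_0, ..., x_{r-1} |-> Q_{r-1}] for the block of a procedure
   lambda x_0 .. x_{r-1}. E *)
Definition beta_env (r : nat) (Qs : nat -> mproc) : env :=
  fun i => if i <? r then inr (Qs (r - 1 - i)) else inl (i - r).

Inductive step_e : mexpr -> mexpr -> Prop :=
| st_beta ts E r Qs : r = length ts ->
    step_e (MApp (MLam ts E) r Qs) (subst_e (beta_env r Qs) E)
| st_case_bot br : step_e (MCase MBot br) MBot
| st_case_num n br : step_e (MCase (MNum n) br) (br n)
| st_case_case G br1 br2 :
    step_e (MCase (MCase G br1) br2) (MCase G (fun i => MCase (br1 i) br2))
| st_scrut G G' br : step_e G G' -> step_e (MCase G br) (MCase G' br)
| st_arg x r Qs j Q' : j < r -> step_p (Qs j) Q' ->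
    step_e (MVar x r Qs)
           (MVar x r (fun i => if i =? j then Q' else Qs i))
| st_branch x r Qs br n E' : step_e (br n) E' ->
    step_e (MCase (MVar x r Qs) br)
           (MCase (MVar x r Qs) (fun i => if i =? n then E' else br i))
with step_p : mproc -> mproc -> Prop :=
| st_lam ts E E' : step_e E E' -> step_p (MLam ts E) (MLam ts E').

Inductive steps_e : mexpr -> mexpr -> Prop :=
| steps_refl E : steps_e E E
| steps_cons E1 E2 E3 : step_e E1 E2 -> steps_e E2 E3 -> steps_e E1 E3.

(* a finite case lists finitely many branches; the remaining ones are bot *)
Inductive fproc : Type :=
| FLam (ts : list ty) (e : fexpr)
with fexpr : Type :=
| FBot
| FNum (n : nat)
| FCase (x : nat) (qs : list fproc) (br : list fexpr).

Definition fdef : fproc := FLam [] FBot.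

Inductive fle_p : fproc -> mproc -> Prop :=
| fle_lam ts e E : fle_e e E -> fle_p (FLam ts e) (MLam ts E)
with fle_e : fexpr -> mexpr -> Prop :=
| fle_bot E : fle_e FBot E
| fle_num n : fle_e (FNum n) (MNum n)
| fle_case x qs br r Qs Br :
    length qs = r ->
    (forall j, j < r -> fle_p (nth j qs fdef) (Qs j)) ->
    (forall i, i < length br -> fle_e (nth i br FBot) (Br i)) ->
    fle_e (FCase x qs br) (MCase (MVar x r Qs) Br).

(* << T >> : the supremum of all finite terms below some reduct of T, i.e.
   the NSP whose finite approximants are exactly those finite terms *)
Definition is_value (T E : mexpr) : Prop :=
  is_nsp_e E /\
  forall t : fexpr, fle_e t E <-> exists T', steps_e T T' /\ fle_e t T'.

Definition value (T : mexpr) : mexpr :=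
  epsilon (inhabits MBot) (is_value T).

(* (lambda x0 x1 .. xr. e) . q = lambda x1 .. xr. << e[x0 |-> q] >> *)
Definition app_env (r : nat) (q : mproc) : env :=
  fun i => if i <? r then inl i
           else if i =? r then inr (ren_p (fun j => j + r) q)
           else inl (i - 1).

Definition nsp_app (p q : mproc) : mproc :=
  match p with
  | MLam (t :: ts) e => MLam ts (value (subst_e (app_env (length ts) q) e))
  | MLam [] e => MLam [] MBot   (* ill-typed; never used for typed terms *)
  end.

CoFixpoint eta (s : ty) (x : nat) : mproc :=
  MLam (argtys s)
    (MCase (MVar (x + length (argtys s)) (length (argtys s))
              (fun j => eta (nth j (argtys s) N) (length (argtys s) - 1 - j)))
           (fun i => MNum i)).

(* F_sigma[g], where g has de Bruijn index d in the surrounding context *)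
CoFixpoint Fsig (s : ty) (d : nat) : mproc :=
  MLam (argtys s)
    (MCase (MVar (d + length (argtys s)) (S (length (argtys s)))
              (fun j => match j with
                        | 0 => Fsig s (d + length (argtys s))
                        | S j' => eta (nth j' (argtys s) N) (length (argtys s) - 1 - j')
                        end))
           (fun i => MNum i)).

Definition lam_merge (s : ty) (P : mproc) : mproc :=
  match P with MLam ts e => MLam (s :: ts) e end.

Definition den_Y (s : ty) : mproc := lam_merge (Arr s s) (Fsig s 0).

Definition noargs : nat -> mproc := fun _ => MLam [] MBot.

Definition den_suc : mproc :=
  MLam [N] (MCase (MVar 0 0 noargs) (fun i => MNum (S i))).
Definition den_pre : mproc :=
  MLam [N] (MCase (MVar 0 0 noargs) (fun i => MNum (i - 1))).
(* lambda x y z : x has index 2, y index 1, z index 0 *)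
Definition den_ifz : mproc :=
  MLam [N; N; N]
    (MCase (MVar 2 0 noargs)
       (fun i => match i with
                 | 0 => MCase (MVar 1 0 noargs) (fun j => MNum j)
                 | S _ => MCase (MVar 0 0 noargs) (fun j => MNum j)
                 end)).
Definition den_C (f : nat -> option nat) : mproc :=
  MLam [N] (MCase (MVar 0 0 noargs)
              (fun i => match f i with Some m => MNum m | None => MBot end)).

Fixpoint den (G : list ty) (M : term) : mproc :=
  match M with
  | Var i => eta (nth i G N) i
  | Lam s M => lam_merge s (den (s :: G) M)
  | App M M' => nsp_app (den G M) (den G M')
  | Numl n => MLam [] (MNum n)
  | Suc => den_suc
  | Pre => den_pre
  | Ifz => den_ifz
  | Yc s => den_Y s
  | Cf f => den_C f
  end.

Definition PCFk_denotable (k : nat) (s : ty) (p : mproc) : Prop :=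
  exists M, closed_PCFk k M s /\ nsp_eq_p (den [] M) p.

(* Main.v *)
(* The proof runs procedures against an opponent that supplies [g] and an opaque
   argument [x] of level [k].  Whenever [g] is called with arguments [F] and [e],
   the opponent checks, by probing with fresh tokens, that [e] behaves as the
   latest token it has handed out for [x]; then it calls [F] on a new token.  The
   fixed point [Y] survives any number of rounds.

   A term with fixed points of level at most [k] is first brought, by
   normalisation by evaluation, into a long normal form with recursive
   definitions, in which every variable of level [k] is bound to a token or to a
   recursive definition.  Closures of level less than [k] cannot transmit a token
   of level [k] faithfully, so [e] passes the check only if the current token is
   lexically in scope at the call of [g].  Hence the code of [F] is a proper part
   of the code in scope of the current token, and the number of rounds is bounded
   by the size of the normal form. *)
From Stdlib Require Import List Arith Lia Classical ClassicalEpsilon FunctionalExtensionality.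
Import ListNotations.
Require Import Defs.

(** * Values of meta-terms *)

(** A value is a supremum picked by [epsilon], so denotations are not computed but run: a run is
    finite and therefore sees only finite approximants. Every simulation goes one way, from the
    value to the meta-term, from substituted code to code with an environment, from procedures to
    normal forms. This suffices, since a winning run of the fixed point only has to be carried into
    a normal form and refuted there.

    The obstacle is that a token of level [k] can be hidden inside closures of lower level, so that
    its absence cannot be demanded of an environment in full depth. This is why a test descends
    through all levels: token [s] must be given an argument that behaves like token [s + 1], down to
    ground type. A closure of level less than [k] may hold the token of level [k], but its arguments
    have level less than [k - 1]; hence it never receives token 1 itself, and the same dilemma
    recurs one level lower for whatever it receives instead.

    Rounds are numbered by the calls still to come. The number thus identifies a fresh token and is
    at the same time the quantity compared with the size of the code. *)

Definition unf_p (P : mproc) : mproc := match P with MLam ts E => MLam ts E end.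
Definition unf_e (E : mexpr) : mexpr :=
  match E with
  | MBot => MBot
  | MNum n => MNum n
  | MCase G br => MCase G br
  | MVar x r Qs => MVar x r Qs
  | MApp P r Qs => MApp P r Qs
  end.
Lemma unf_pE P : P = unf_p P.  Proof. now destruct P. Qed.
Lemma unf_eE E : E = unf_e E.  Proof. now destruct E. Qed.

Definition stack := list (nat -> mexpr).

Fixpoint plug (T : mexpr) (K : stack) : mexpr :=
  match K with [] => T | b :: K => plug (MCase T b) K end.

Inductive hnf : Type :=
| HNum (n : nat)
| HVar (x r : nat) (Qs : nat -> mproc) (b : nat -> mexpr) (K : stack).

(** Head reduction with the surrounding [case] contexts on a stack. Pushing a [case] replaces the
    [case-case] rule and makes the head form unique. A variable needs a nonempty stack, because
    applications occur in NSPs only as scrutinees. *)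
Inductive hd : mexpr -> stack -> hnf -> Prop :=
| hd_num n : hd (MNum n) [] (HNum n)
| hd_pop n b K H : hd (b n) K H -> hd (MNum n) (b :: K) H
| hd_case G b K H : hd G (b :: K) H -> hd (MCase G b) K H
| hd_app ts E r Qs K H : r = length ts ->
    hd (subst_e (beta_env r Qs) E) K H -> hd (MApp (MLam ts E) r Qs) K H
| hd_var x r Qs b K : hd (MVar x r Qs) (b :: K) (HVar x r Qs b K).

Lemma hd_fun T K H1 : hd T K H1 -> forall H2, hd T K H2 -> H1 = H2.
Proof. induction 1; intros H2 h2; inversion h2; subst; auto. Qed.

(** Approximants read off from iterated head forms, as for Boehm trees. Being tied to a unique head
    form, they are easier to handle than arbitrary reducts; [fle_apx], [steps_apx] and [apx_steps]
    identify them with the finite terms below a reduct. *)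
Inductive apx : fexpr -> mexpr -> stack -> Prop :=
| apx_bot T K : apx FBot T K
| apx_num n T K : hd T K (HNum n) -> apx (FNum n) T K
| apx_case x qs br T K r Qs b K' :
    hd T K (HVar x r Qs b K') -> length qs = r ->
    (forall j, j < r -> apxp (nth j qs fdef) (Qs j)) ->
    (forall i, i < length br -> apx (nth i br FBot) (b i) K') ->
    apx (FCase x qs br) T K
with apxp : fproc -> mproc -> Prop :=
| apx_lam ts e E : apx e E [] -> apxp (FLam ts e) (MLam ts E).

Scheme apx_mind := Minimality for apx Sort Prop
with apxp_mind := Minimality for apxp Sort Prop.
Combined Scheme apx_mutind from apx_mind, apxp_mind.
Scheme fle_e_mind := Minimality for fle_e Sort Prop
with fle_p_mind := Minimality for fle_p Sort Prop.
Combined Scheme fle_mutind from fle_e_mind, fle_p_mind.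
Scheme step_e_mind := Minimality for step_e Sort Prop
with step_p_mind := Minimality for step_p Sort Prop.

Lemma apx_hd_back t T' T K K' :
  (forall H, hd T' K' H -> hd T K H) -> apx t T' K' -> apx t T K.
Proof. intros h a; inversion a; subst; econstructor; eauto. Qed.

(** The definition of [value] by [epsilon] says nothing until some value is known to exist; this is
    the witness. Having a head form is undecidable, hence the use of excluded middle. *)
CoFixpoint nrm (T : mexpr) (K : stack) : mexpr :=
  match excluded_middle_informative (exists H, hd T K H) with
  | left e =>
      match proj1_sig (constructive_indefinite_description _ e) with
      | HNum n => MNum n
      | HVar x r Qs b K' =>
          MCase (MVar x r (fun j => match Qs j with MLam ts E => MLam ts (nrm E []) end))
                (fun i => nrm (b i) K')
      end
  | right _ => MBot
  end.

Definition nrmp (P : mproc) : mproc := match P with MLam ts E => MLam ts (nrm E []) end.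

Lemma nrm_num T K n : hd T K (HNum n) -> nrm T K = MNum n.
Proof.
  intros h; rewrite (unf_eE (nrm T K)); simpl.
  destruct (excluded_middle_informative (exists H, hd T K H)) as [e|ne]; [|now destruct ne; eauto].
  destruct (constructive_indefinite_description _ e) as [H h']; cbn.
  now rewrite <- (hd_fun _ _ _ h _ h').
Qed.

Lemma nrm_var T K x r Qs b K' : hd T K (HVar x r Qs b K') ->
  nrm T K = MCase (MVar x r (fun j => nrmp (Qs j))) (fun i => nrm (b i) K').
Proof.
  intros h; rewrite (unf_eE (nrm T K)); simpl.
  destruct (excluded_middle_informative (exists H, hd T K H)) as [e|ne]; [|now destruct ne; eauto].
  destruct (constructive_indefinite_description _ e) as [H h']; cbn.
  now rewrite <- (hd_fun _ _ _ h _ h').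
Qed.

Lemma nrm_bot T K : ~ (exists H, hd T K H) -> nrm T K = MBot.
Proof.
  intros h; rewrite (unf_eE (nrm T K)); simpl.
  now destruct (excluded_middle_informative (exists H, hd T K H)) as [e|ne].
Qed.

CoFixpoint nrm_nsp (T : mexpr) (K : stack) : is_nsp_e (nrm T K).
Proof.
  destruct (classic (exists H, hd T K H)) as [[[n|x r Qs b K'] h]|h].
  - rewrite (nrm_num _ _ _ h); constructor.
  - rewrite (nrm_var _ _ _ _ _ _ _ h); constructor.
    + intros j _; destruct (Qs j); constructor; apply nrm_nsp.
    + intros i; apply nrm_nsp.
  - rewrite (nrm_bot _ _ h); constructor.
Qed.

Lemma fle_nrm :
  (forall t E, fle_e t E -> forall T K, E = nrm T K -> apx t T K) /\
  (forall q P, fle_p q P -> forall Q, P = nrmp Q -> apxp q Q).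
Proof.
  apply fle_mutind; intros.
  - constructor.
  - destruct (classic (exists H, hd T K H)) as [[[m|x r Qs b K'] h]|h].
    + rewrite (nrm_num _ _ _ h) in H; injection H as ->; now constructor.
    + now rewrite (nrm_var _ _ _ _ _ _ _ h) in H.
    + now rewrite (nrm_bot _ _ h) in H.
  - destruct (classic (exists H, hd T K H)) as [[[m|x' r' Qs' b K'] h]|h].
    + now rewrite (nrm_num _ _ _ h) in H4.
    + rewrite (nrm_var _ _ _ _ _ _ _ h) in H4; injection H4 as -> -> -> ->.
      econstructor; eauto.
    + now rewrite (nrm_bot _ _ h) in H4.
  - destruct Q as [ts' E']; injection H1 as -> ->; constructor; eauto.
Qed.

Lemma apx_nrm :
  (forall t T K, apx t T K -> fle_e t (nrm T K)) /\
  (forall q Q, apxp q Q -> fle_p q (nrmp Q)).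
Proof.
  apply apx_mutind; intros.
  - constructor.
  - rewrite (nrm_num _ _ _ H); constructor.
  - rewrite (nrm_var _ _ _ _ _ _ _ H); constructor; auto.
  - now constructor.
Qed.

Lemma fle_apx :
  (forall t E, fle_e t E -> apx t E []) /\ (forall q P, fle_p q P -> apxp q P).
Proof.
  apply fle_mutind; intros; try (now constructor).
  - constructor; constructor.
  - econstructor; [constructor; constructor|auto..].
Qed.

(* [(fun i => MCase (b1 i) b2) :: K] and [b1 :: b2 :: K] have the same finite
   approximants, although they need not have common reducts: the [case-case]
   rule would have to be applied in infinitely many branches. *)
Inductive stk_merge : stack -> stack -> Prop :=
| sm_refl K : stk_merge K K
| sm_cons b K K' : stk_merge K K' -> stk_merge (b :: K) (b :: K')
| sm_merge b1 b2 K : stk_merge ((fun i => MCase (b1 i) b2) :: K) (b1 :: b2 :: K).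

Inductive conf_merge : mexpr -> stack -> mexpr -> stack -> Prop :=
| cm_same T K K' : stk_merge K K' -> conf_merge T K T K'
| cm_case T b K : conf_merge (MCase T b) K T (b :: K).

Definition hnf_merge (H H' : hnf) : Prop :=
  match H, H' with
  | HNum n, HNum n' => n = n'
  | HVar x r Qs b K, HVar x' r' Qs' b' K' =>
      x = x' /\ r = r' /\ Qs = Qs' /\ forall i, conf_merge (b i) K (b' i) K'
  | _, _ => False
  end.

Lemma hnf_merge_refl H : hnf_merge H H.
Proof. destruct H; cbn; auto; repeat split; repeat constructor. Qed.

Lemma hd_merge T K H : hd T K H -> forall K', stk_merge K K' ->
  exists H', hd T K' H' /\ hnf_merge H H'.
Proof.
  induction 1; intros K0 sm.
  - inversion sm; subst; eexists; split; [constructor|reflexivity].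
  - inversion sm; subst.
    + exists H; split; [now constructor|apply hnf_merge_refl].
    + destruct (IHhd _ H4) as [H' []]; exists H'; split; auto; now constructor.
    + inversion H0; subst; exists H; split; [now constructor|apply hnf_merge_refl].
  - destruct (IHhd (b :: K0)) as [H' []]; [now constructor|].
    exists H'; split; auto; now constructor.
  - destruct (IHhd _ sm) as [H' []]; exists H'; split; auto; now constructor.
  - inversion sm; subst.
    + eexists; split; [constructor|apply hnf_merge_refl].
    + eexists; split; [constructor|cbn; repeat split; now constructor].
    + eexists; split; [constructor|cbn; repeat split; constructor].
Qed.

Lemma apx_merge :
  (forall t T K, apx t T K -> forall T' K', conf_merge T K T' K' -> apx t T' K') /\
  (forall q Q, apxp q Q -> True).
Proof.
  apply apx_mutind; intros; auto.
  - constructor.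
  - inversion H0; subst.
    + destruct (hd_merge _ _ _ H _ H1) as [[m|] [h m']]; [cbn in m'; subst m; now constructor|easy].
    + inversion H; subst; now constructor.
  - inversion H5 as [? ? ? sm|]; subst.
    + destruct (hd_merge _ _ _ H _ sm) as [[m|x' r' Qs' b' K1] [h m']]; [easy|].
      cbn in m'; destruct m' as (<- & <- & <- & m'); econstructor; eauto.
    + inversion H; subst; econstructor; eauto.
Qed.

(** Approximants pull back along every step. Most steps only prolong a head run; for [case-case] the
    stacks really differ, and [apx_merge] bridges the gap. *)
Lemma step_apx T T' : step_e T T' -> forall t K, apx t T' K -> apx t T K.
Proof.
  revert T T'.
  apply (step_e_mind (fun T T' => forall t K, apx t T' K -> apx t T K)
           (fun P P' => forall q, apxp q P' -> apxp q P)); intros.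
  - eapply apx_hd_back; [|exact H0]; intros; now constructor.
  - inversion H; subst; [constructor|inversion H0..].
  - eapply apx_hd_back; [|exact H]; intros; now do 2 constructor.
  - eapply apx_hd_back with (T' := G) (K' := br1 :: br2 :: K);
      [intros; now do 2 constructor|].
    eapply (proj1 apx_merge) with (T := G) (K := (fun i => MCase (br1 i) br2) :: K);
      [|constructor; constructor].
    eapply apx_hd_back; [|exact H]; intros h h'; now inversion h'.
  - eapply apx_hd_back with (T' := G) (K' := br :: K); [intros; now constructor|].
    apply H0; eapply apx_hd_back; [|exact H1]; intros h h'; now inversion h'.
  - inversion H2 as [|? ? ? hh|? ? ? ? ? ? ? ? ? hh hl ha hb]; subst; [constructor|inversion hh|].
    inversion hh; subst; econstructor; [constructor|reflexivity| |exact hb].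
    intros i Hi; specialize (ha i Hi); cbn in ha.
    destruct (Nat.eqb_spec i j); subst; auto.
  - inversion H1 as [|? ? ? hh|? ? ? ? ? ? ? ? ? hh hl ha hb]; subst;
      [constructor|inversion hh as [| |? ? ? ? hh'| |]; inversion hh'|].
    inversion hh as [| |? ? ? ? hh'| |]; subst; inversion hh'; subst.
    econstructor; [constructor; constructor|reflexivity|exact ha|].
    intros i Hi; specialize (hb i Hi); cbn in hb.
    destruct (Nat.eqb_spec i n); subst; auto.
  - inversion H1; subst; constructor; auto.
Qed.

Lemma steps_apx T T' : steps_e T T' -> forall t K, apx t T' K -> apx t T K.
Proof. induction 1; intros; auto. eapply step_apx; eauto. Qed.

Lemma steps_trans A B C : steps_e A B -> steps_e B C -> steps_e A C.
Proof. induction 1; intros; auto. econstructor; eauto. Qed.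

Lemma step_plug K T T' : step_e T T' -> step_e (plug T K) (plug T' K).
Proof.
  revert T T'; induction K as [|b K IH]; intros T T' h; cbn; auto.
  apply IH; now constructor.
Qed.

Lemma steps_plug_var K V b x r Qs : V = MVar x r Qs ->
  steps_e (plug (MCase V b) K) (MCase V (fun i => plug (b i) K)).
Proof.
  intros ->; revert b; induction K as [|b' K IH]; intros b; cbn; [constructor|].
  econstructor; [apply step_plug; constructor|].
  apply (IH (fun i => MCase (b i) b')).
Qed.

Lemma hd_steps T K H : hd T K H ->
  match H with
  | HNum n => steps_e (plug T K) (MNum n)
  | HVar x r Qs b K' =>
      steps_e (plug T K) (MCase (MVar x r Qs) (fun i => plug (b i) K'))
  end.
Proof.
  induction 1; cbn.
  - constructor.
  - destruct H; (econstructor; [apply step_plug; constructor|exact IHhd]).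
  - exact IHhd.
  - destruct H; (econstructor; [apply step_plug; now constructor|exact IHhd]).
  - eapply steps_plug_var; reflexivity.
Qed.

(** A step rewrites a single argument, so the arguments are brought above their approximants one
    after another; the last conjunct keeps those not yet treated intact. *)
Lemma steps_args x r b qs : forall m Qs, m <= r ->
  (forall j, j < m -> exists ts E E', Qs j = MLam ts E /\ steps_e E E' /\
     fle_p (nth j qs fdef) (MLam ts E')) ->
  exists Qs', steps_e (MCase (MVar x r Qs) b) (MCase (MVar x r Qs') b) /\
    (forall j, j < m -> fle_p (nth j qs fdef) (Qs' j)) /\
    (forall j, m <= j -> Qs' j = Qs j).
Proof.
  induction m as [|m IH]; intros Qs Hm h.
  - exists Qs; repeat split; [constructor|lia].
  - destruct (IH Qs) as (Qs1 & st1 & l1 & e1); [lia|intros; apply h; lia|].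
    destruct (h m) as (ts & E & E' & eq & st & l); [lia|].
    assert (eq1 : Qs1 m = MLam ts E) by (rewrite e1; auto).
    assert (G : exists Qs2, steps_e (MCase (MVar x r Qs1) b) (MCase (MVar x r Qs2) b) /\
               Qs2 m = MLam ts E' /\ forall j, j <> m -> Qs2 j = Qs1 j).
    { clear - eq1 st Hm. revert Qs1 eq1; induction st; intros.
      - exists Qs1; repeat split; auto; constructor.
      - destruct (IHst (fun i => if i =? m then MLam ts E2 else Qs1 i)) as (Qs2 & a & a' & a'').
        + now rewrite Nat.eqb_refl.
        + exists Qs2; repeat split; auto.
          * econstructor; [|exact a]. apply st_scrut, st_arg; [lia|].
            rewrite eq1; now constructor.
          * intros j Hj; rewrite a''; auto; now apply Nat.eqb_neq in Hj as ->. }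
    destruct G as (Qs2 & st2 & e2 & e2'). exists Qs2; repeat split.
    + eapply steps_trans; eauto.
    + intros j Hj; destruct (Nat.eq_dec j m) as [->|]; [now rewrite e2|].
      rewrite e2'; auto; apply l1; lia.
    + intros j Hj; rewrite e2'; [apply e1|]; lia.
Qed.

Lemma steps_branches x r Qs br : forall m b,
  (forall i, i < m -> exists E', steps_e (b i) E' /\ fle_e (nth i br FBot) E') ->
  exists b', steps_e (MCase (MVar x r Qs) b) (MCase (MVar x r Qs) b') /\
    (forall i, i < m -> fle_e (nth i br FBot) (b' i)) /\
    (forall i, m <= i -> b' i = b i).
Proof.
  induction m as [|m IH]; intros b h.
  - exists b; repeat split; [constructor|lia].
  - destruct (IH b) as (b1 & st1 & l1 & e1); [intros; apply h; lia|].
    destruct (h m) as (E' & st & l); [lia|].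
    rewrite <- (e1 m (le_n _)) in st.
    assert (G : exists b2, steps_e (MCase (MVar x r Qs) b1) (MCase (MVar x r Qs) b2) /\
               b2 m = E' /\ forall j, j <> m -> b2 j = b1 j).
    { clear - st. remember (b1 m) as E eqn:eq1; symmetry in eq1.
      revert b1 eq1; induction st; intros.
      - exists b1; repeat split; auto; constructor.
      - destruct (IHst (fun i => if i =? m then E2 else b1 i)) as (Qs2 & a & a' & a'').
        + now rewrite Nat.eqb_refl.
        + exists Qs2; repeat split; auto.
          * econstructor; [|exact a]. apply st_branch; now rewrite eq1.
          * intros j Hj; rewrite a''; auto; now apply Nat.eqb_neq in Hj as ->. }
    destruct G as (b2 & st2 & e2 & e2'). exists b2; repeat split.
    + eapply steps_trans; eauto.
    + intros j Hj; destruct (Nat.eq_dec j m) as [->|]; [now rewrite e2|].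
      rewrite e2'; auto; apply l1; lia.
    + intros j Hj; rewrite e2'; [apply e1|]; lia.
Qed.

Lemma apx_steps :
  (forall t T K, apx t T K -> exists T', steps_e (plug T K) T' /\ fle_e t T') /\
  (forall q Q, apxp q Q -> exists ts E E', Q = MLam ts E /\ steps_e E E' /\
     fle_p q (MLam ts E')).
Proof.
  apply apx_mutind; intros.
  - eexists; split; constructor.
  - apply hd_steps in H; eexists; split; [exact H|constructor].
  - apply hd_steps in H.
    destruct (steps_args x r (fun i => plug (b i) K') qs r Qs) as (Qs' & s1 & l1 & _); auto.
    destruct (steps_branches x r Qs' br (length br) (fun i => plug (b i) K'))
      as (b' & s2 & l2 & _); auto.
    eexists; split; [eapply steps_trans; [exact H|eapply steps_trans; eauto]|].
    now constructor.
  - destruct H0 as (E' & s & l); exists ts, E, E'; repeat split; auto.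
Qed.

(** With [nrm T []] as witness, [epsilon_spec] applies. The inclusion recorded here is the direction
    of the simulations: whatever is observed of the value is already an observation of the
    meta-term. *)
Lemma value_spec T : is_nsp_e (value T) /\ forall t, fle_e t (value T) -> apx t T [].
Proof.
  assert (ex : is_value T (value T)).
  { apply (epsilon_spec (inhabits MBot) (is_value T)); exists (nrm T []); split; [apply nrm_nsp|]; intros t; split.
    - intros l; apply (proj1 fle_nrm) with (T := T) (K := []) in l; auto.
      exact (proj1 apx_steps _ _ _ l).
    - intros (T' & s & l); apply (proj1 apx_nrm).
      eapply steps_apx; eauto; now apply (proj1 fle_apx). }
  destruct ex as [n e]; split; auto; intros t l.
  apply e in l as (T' & s & l); eapply steps_apx; eauto; now apply (proj1 fle_apx).
Qed.

(** * A machine running procedures against an opponent *)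

(* [Idle r]: [r] calls of [g] are still to come.  [Test r s]: the opponent is
   checking, in round [r], that a procedure behaves like its own token [x_r];
   the only token that may be called now is the one numbered [s]. *)
Inductive state : Type := Idle (r : nat) | Test (r s : nat).

(** [ROk] and [RWin] behave as exceptions: they pass through every enclosing [case], so that an
    accepted call ends the run whatever code surrounds it. *)
Inductive result : Type := RNum (n : nat) | ROk | RWin.

Inductive nclo : Type :=
| NC (P : mproc) (rho : nat -> nclo)
| NG
| NO (s r : nat).

Definition ncons (c : nclo) (rho : nat -> nclo) (i : nat) : nclo :=
  match i with 0 => c | S i => rho i end.

Fixpoint next (args : list nclo) (rho : nat -> nclo) : nat -> nclo :=
  match args with [] => rho | c :: args => next args (ncons c rho) end.

Definition nargs (r : nat) (Qs : nat -> mproc) (rho : nat -> nclo) : list nclo :=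
  map (fun j => NC (Qs j) rho) (seq 0 r).

(** A procedure of ground type is called without arguments, which is the situation once [s] exceeds
    [k]. *)
Definition ntok (k s r : nat) : list nclo := if s <=? k then [NO s r] else [].

(* The token [NO s r] has the pure type of level [k - s]. *)
Inductive neval (k : nat) : nat -> mexpr -> (nat -> nclo) -> state -> result -> Prop :=
| ne_num n m rho st : neval k (S n) (MNum m) rho st (RNum m)
| ne_case n G br rho st m res : neval k n G rho st (RNum m) ->
    neval k n (br m) rho st res -> neval k (S n) (MCase G br) rho st res
| ne_exn n G br rho st res : neval k n G rho st res -> (forall m, res <> RNum m) ->
    neval k (S n) (MCase G br) rho st res
| ne_var n x r Qs rho st res : ncall k n (rho x) (nargs r Qs rho) st res ->
    neval k (S n) (MVar x r Qs) rho st res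
| ne_app n P r Qs rho st res : ncall k n (NC P rho) (nargs r Qs rho) st res ->
    neval k (S n) (MApp P r Qs) rho st res
with ncall (k : nat) : nat -> nclo -> list nclo -> state -> result -> Prop :=
| nc_clo n ts E rho args st res : length args = length ts ->
    neval k n E (next args rho) st res -> ncall k (S n) (NC (MLam ts E) rho) args st res
| nc_G0 n F e : ncall k (S n) NG [F; e] (Idle 0) RWin
| nc_GS n F e r : ncall k n e [NO 1 (S r)] (Test (S r) 0) ROk ->
    ncall k n F [NO 0 r] (Idle r) RWin -> ncall k (S n) NG [F; e] (Idle (S r)) RWin
| nc_O n s r W : s < k -> ncall k n W (ntok k (S (S s)) r) (Test r (S s)) ROk ->
    ncall k (S n) (NO s r) [W] (Test r s) ROk
| nc_Ok n r : ncall k (S n) (NO k r) [] (Test r k) ROk.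

Scheme neval_mind := Minimality for neval Sort Prop
with ncall_mind := Minimality for ncall Sort Prop.
Combined Scheme nev_mutind from neval_mind, ncall_mind.

Definition NEval k E rho st res := exists n, neval k n E rho st res.
Definition NCall k c args st res := exists n, ncall k n c args st res.

Lemma nev_mono k :
  (forall n E rho st res, neval k n E rho st res ->
     forall n', n <= n' -> neval k n' E rho st res) /\
  (forall n c args st res, ncall k n c args st res ->
     forall n', n <= n' -> ncall k n' c args st res).
Proof.
  apply nev_mutind; intros; destruct n' as [|n']; try lia;
    econstructor; solve [eauto | match goal with h : forall _, _ -> _ |- _ => apply h; lia end].
Qed.

Lemma NEval_num k m rho st : NEval k (MNum m) rho st (RNum m).
Proof. exists 1; constructor. Qed.

Lemma NEval_case k G br rho st m res : NEval k G rho st (RNum m) ->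
  NEval k (br m) rho st res -> NEval k (MCase G br) rho st res.
Proof.
  intros [a ha] [b hb]; exists (S (max a b)); econstructor;
    eapply (proj1 (nev_mono k)); eauto; lia.
Qed.

Lemma NEval_exn k G br rho st res : NEval k G rho st res -> (forall m, res <> RNum m) ->
  NEval k (MCase G br) rho st res.
Proof. intros [a ha]; exists (S a); now econstructor. Qed.

Lemma NEval_case_inv k G br rho st res : NEval k (MCase G br) rho st res ->
  (exists m, NEval k G rho st (RNum m) /\ NEval k (br m) rho st res) \/
  (NEval k G rho st res /\ forall m, res <> RNum m).
Proof.
  intros [n h]; inversion h; subst; [left; exists m; split; eexists; eauto|].
  right; split; auto; eexists; eauto.
Qed.

Lemma NEval_id k G rho st res : NEval k (MCase G MNum) rho st res <-> NEval k G rho st res.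
Proof.
  split.
  - intros h; apply NEval_case_inv in h as [(m & h1 & [n h2])|[h _]]; auto.
    inversion h2; now subst.
  - intros h; destruct res; [|apply NEval_exn; auto; discriminate..].
    eapply NEval_case; eauto; apply NEval_num.
Qed.

Lemma NEval_var k x r Qs rho st res :
  NEval k (MVar x r Qs) rho st res <-> NCall k (rho x) (nargs r Qs rho) st res.
Proof.
  split; intros [n h]; [inversion h; subst; eexists; eauto|exists (S n); now constructor].
Qed.

Lemma NEval_app k P r Qs rho st res :
  NEval k (MApp P r Qs) rho st res <-> NCall k (NC P rho) (nargs r Qs rho) st res.
Proof.
  split; intros [n h]; [inversion h; subst; eexists; eauto|exists (S n); now constructor].
Qed.

Lemma NCall_clo k ts E rho args st res :
  NCall k (NC (MLam ts E) rho) args st res <->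
  length args = length ts /\ NEval k E (next args rho) st res.
Proof.
  split.
  - intros [n h]; inversion h; subst; split; auto; eexists; eauto.
  - intros [l [n h]]; exists (S n); now constructor.
Qed.

Lemma NCall_GS k F e r : NCall k e [NO 1 (S r)] (Test (S r) 0) ROk ->
  NCall k F [NO 0 r] (Idle r) RWin -> NCall k NG [F; e] (Idle (S r)) RWin.
Proof.
  intros [a ha] [b hb]; exists (S (max a b)); econstructor;
    eapply (proj2 (nev_mono k)); eauto; lia.
Qed.

Lemma NCall_O k s r W : s < k -> NCall k W (ntok k (S (S s)) r) (Test r (S s)) ROk ->
  NCall k (NO s r) [W] (Test r s) ROk.
Proof. intros l [a ha]; exists (S a); now constructor. Qed.

Lemma next_ge args : forall rho i, next args rho (i + length args) = rho i.
Proof.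
  induction args as [|c args IH]; intros rho i; cbn; [f_equal; lia|].
  now rewrite <- Nat.add_succ_comm, IH.
Qed.

Lemma next_lt d args : forall rho i, i < length args ->
  next args rho i = nth (length args - 1 - i) args d.
Proof.
  induction args as [|c args IH]; intros rho i Hi; cbn in *; [lia|].
  destruct (Nat.eq_dec i (length args)) as [->|ne].
  - replace (length args - 0 - length args) with 0 by lia.
    exact (next_ge args (ncons c rho) 0).
  - rewrite IH by lia.
    now replace (length args - 0 - i) with (S (length args - 1 - i)) by lia.
Qed.

Lemma next_sim (S : nclo -> nclo -> Prop) args args' : Forall2 S args args' ->
  forall rho rho', (forall i, S (rho i) (rho' i)) ->
  forall i, S (next args rho i) (next args' rho' i).
Proof.
  induction 1 as [|c c' l l' h _ IH]; intros rho rho' hr; cbn; auto.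
  apply IH; intros [|i]; cbn; auto.
Qed.

Lemma next_nth args rho j d : j < length args ->
  next args rho (length args - 1 - j) = nth j args d.
Proof. intros h; rewrite (next_lt d) by lia; f_equal; lia. Qed.

Lemma nargs_sim (S : nclo -> nclo -> Prop) r Qs Qs' rho rho' :
  (forall j, j < r -> S (NC (Qs j) rho) (NC (Qs' j) rho')) ->
  Forall2 S (nargs r Qs rho) (nargs r Qs' rho').
Proof.
  intros h; unfold nargs.
  assert (g : forall j, In j (seq 0 r) -> j < r) by (intros j Hj; apply in_seq in Hj; lia).
  induction (seq 0 r) as [|j l IH]; cbn; constructor; auto with datatypes.
Qed.

Lemma nargs_length r Qs rho : length (nargs r Qs rho) = r.
Proof. unfold nargs; now rewrite length_map, length_seq. Qed.

Lemma nargs_sim_l (S : nclo -> nclo -> Prop) d r Qs rho args :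
  length args = r -> (forall j, j < r -> S (NC (Qs j) rho) (nth j args d)) ->
  Forall2 S (nargs r Qs rho) args.
Proof.
  intros <- h.
  replace args with (map (fun j => nth j args d) (seq 0 (length args))).
  2:{ apply nth_ext with (d := d) (d' := d); rewrite length_map, length_seq; auto.
      intros n Hn; rewrite nth_indep with (d' := nth 0 args d)
        by now rewrite length_map, length_seq.
      rewrite (map_nth (fun j => nth j args d)), seq_nth; auto. }
  rewrite length_map, length_seq; unfold nargs.
  assert (g : forall j, In j (seq 0 (length args)) -> j < length args)
    by (intros j Hj; apply in_seq in Hj; lia).
  induction (seq 0 (length args)) as [|j l IH]; cbn; constructor; auto with datatypes.
Qed.

Lemma subst_pE sg ts e : subst_p sg (MLam ts e) = MLam ts (subst_e (usub (length ts) sg) e).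
Proof. now rewrite (unf_pE (subst_p _ _)). Qed.
Lemma ren_pE th ts e : ren_p th (MLam ts e) = MLam ts (ren_e (uren (length ts) th) e).
Proof. now rewrite (unf_pE (ren_p _ _)). Qed.
Lemma subst_eE sg E : subst_e sg E =
  match E with
  | MBot => MBot
  | MNum n => MNum n
  | MCase G br => MCase (subst_e sg G) (fun i => subst_e sg (br i))
  | MVar x r Qs =>
      match sg x with
      | inl y => MVar y r (fun j => subst_p sg (Qs j))
      | inr Q => MApp Q r (fun j => subst_p sg (Qs j))
      end
  | MApp P r Qs => MApp (subst_p sg P) r (fun j => subst_p sg (Qs j))
  end.
Proof. rewrite (unf_eE (subst_e _ _)); destruct E; simpl; auto; now destruct (sg x). Qed.
Lemma ren_eE th E : ren_e th E =
  match E with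
  | MBot => MBot
  | MNum n => MNum n
  | MCase G br => MCase (ren_e th G) (fun i => ren_e th (br i))
  | MVar x r Qs => MVar (th x) r (fun j => ren_p th (Qs j))
  | MApp P r Qs => MApp (ren_p th P) r (fun j => ren_p th (Qs j))
  end.
Proof. rewrite (unf_eE (ren_e _ _)); now destruct E. Qed.
Lemma etaE s x : eta s x = MLam (argtys s)
    (MCase (MVar (x + length (argtys s)) (length (argtys s))
              (fun j => eta (nth j (argtys s) N) (length (argtys s) - 1 - j)))
           (fun i => MNum i)).
Proof. now rewrite (unf_pE (eta s x)) at 1. Qed.
Lemma FsigE s d : Fsig s d = MLam (argtys s)
    (MCase (MVar (d + length (argtys s)) (S (length (argtys s)))
              (fun j => match j with
                        | 0 => Fsig s (d + length (argtys s))
                        | S j' => eta (nth j' (argtys s) N) (length (argtys s) - 1 - j')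
                        end))
           (fun i => MNum i)).
Proof. now rewrite (unf_pE (Fsig s d)) at 1. Qed.

(** * Substitution versus environments *)

(** On the left a substitution has been carried out in the code, on the right it is delayed in the
    environment. [ss_ren] moves a renaming of the left code into its environment; it is needed
    because [usub] shifts the substituted procedures under binders. *)
Inductive sim_sub : nclo -> nclo -> Prop :=
| ss_G : sim_sub NG NG
| ss_O s r : sim_sub (NO s r) (NO s r)
| ss_cong P rho rho' : (forall i, sim_sub (rho i) (rho' i)) -> sim_sub (NC P rho) (NC P rho')
| ss_subst sg P rho rho' :
    (forall i j, sg i = inl j -> sim_sub (rho j) (rho' i)) ->
    (forall i Q, sg i = inr Q -> sim_sub (NC Q rho) (rho' i)) ->
    sim_sub (NC (subst_p sg P) rho) (NC P rho')
| ss_ren th P rho c' :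
    sim_sub (NC P (fun i => rho (th i))) c' -> sim_sub (NC (ren_p th P) rho) c'.

Inductive sim_sub_e : mexpr -> (nat -> nclo) -> mexpr -> (nat -> nclo) -> Prop :=
| se_cong E rho rho' : (forall i, sim_sub (rho i) (rho' i)) -> sim_sub_e E rho E rho'
| se_subst sg E rho rho' :
    (forall i j, sg i = inl j -> sim_sub (rho j) (rho' i)) ->
    (forall i Q, sg i = inr Q -> sim_sub (NC Q rho) (rho' i)) ->
    sim_sub_e (subst_e sg E) rho E rho'
| se_ren th E rho E' rho' :
    sim_sub_e E (fun i => rho (th i)) E' rho' -> sim_sub_e (ren_e th E) rho E' rho'.

Lemma sim_sub_refl c : sim_sub c c.
Proof. induction c; constructor; auto. Qed.

Lemma sim_sub_clo c c' : sim_sub c c' -> forall ts E rho args args',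
  c = NC (MLam ts E) rho -> Forall2 sim_sub args args' -> length args = length ts ->
  exists E' rho', c' = NC (MLam ts E') rho' /\
    sim_sub_e E (next args rho) E' (next args' rho').
Proof.
  induction 1 as [| |P rho1 rho2 h IH|sg P rho1 rho2 h1 IH1 h2 IH2|th P rho1 c' h IH];
    intros ts E rho args args' eq ha hl; try discriminate.
  - injection eq as -> ->; exists E, rho2; split; auto.
    constructor; now apply next_sim.
  - destruct P as [ts0 E0]; rewrite subst_pE in eq; injection eq as <- <- <-.
    exists E0, rho2; split; auto.
    assert (hl' : length args' = length args) by (symmetry; now apply Forall2_length in ha).
    apply se_subst; unfold usub; intros i; destruct (Nat.ltb_spec i (length ts0)) as [lt|ge].
    + intros j [= <-]. rewrite !(next_lt NG), hl' by lia.
      clear - ha; revert args' ha; generalize (length args - 1 - i) as j.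
      intros j args' ha; revert j; induction ha; intros [|j]; cbn; auto; constructor.
    + intros j. destruct (sg (i - length ts0)) as [j0|Q] eqn:es; intros [= <-].
      replace i with (i - length ts0 + length args') by lia.
      rewrite <- hl, !next_ge, hl; eauto.
    + discriminate.
    + intros Q'. destruct (sg (i - length ts0)) as [j0|Q] eqn:es; intros [= <-].
      replace i with (i - length ts0 + length args') by lia. rewrite next_ge.
      apply ss_ren. rewrite <- hl.
      replace (fun i0 => next args rho1 (i0 + length args)) with rho1; [rewrite hl; eauto|].
      apply functional_extensionality; intros; now rewrite next_ge.
  - destruct P as [ts0 E0]; rewrite ren_pE in eq; injection eq as <- <- <-.
    destruct (IH _ _ _ _ _ eq_refl ha hl) as (E' & rho' & -> & h').
    exists E', rho'; split; auto. apply se_ren.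
    replace (fun i => next args rho1 (uren (length ts0) th i))
      with (next args (fun i => rho1 (th i))); auto.
    apply functional_extensionality; intros i; unfold uren.
    destruct (Nat.ltb_spec i (length ts0)).
    + rewrite !(next_lt NG); auto; lia.
    + replace i with (i - length ts0 + length args) at 1 by lia.
      now rewrite next_ge, <- hl, next_ge, hl.
Qed.

(** Inversion of [sim_sub_e] by the head constructor of the left term, with all pending
    substitutions and renamings pushed one layer down. An application on the left may face a
    variable on the right, namely one that was substituted. [MBot] has no run, so anything simulates
    it. *)
Definition sim_sub_shape (E : mexpr) (rho : nat -> nclo) (E' : mexpr) (rho' : nat -> nclo) :=
  let args Qs Qs' := forall j : nat, sim_sub (NC (Qs j) rho) (NC (Qs' j) rho') in
  match E with
  | MBot => True
  | MNum n => E' = MNum n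
  | MCase G b => exists G' b', E' = MCase G' b' /\ sim_sub_e G rho G' rho' /\
                   forall i, sim_sub_e (b i) rho (b' i) rho'
  | MVar x r Qs => exists x' Qs', E' = MVar x' r Qs' /\ sim_sub (rho x) (rho' x') /\ args Qs Qs'
  | MApp P r Qs =>
      (exists P' Qs', E' = MApp P' r Qs' /\ sim_sub (NC P rho) (NC P' rho') /\ args Qs Qs') \/
      (exists x' Qs', E' = MVar x' r Qs' /\ sim_sub (NC P rho) (rho' x') /\ args Qs Qs')
  end.

Lemma sim_sub_e_shape E rho E' rho' : sim_sub_e E rho E' rho' -> sim_sub_shape E rho E' rho'.
Proof.
  induction 1 as [E rho rho' h|sg E rho rho' h1 h2|th E rho E' rho' h IH].
  - destruct E; cbn; auto.
    + do 2 eexists; repeat split; intros; now constructor.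
    + do 2 eexists; repeat split; intros; auto; now constructor.
    + left; do 2 eexists; repeat split; intros; now constructor.
  - rewrite subst_eE; destruct E; cbn; auto.
    + do 2 eexists; repeat split; intros; now constructor.
    + destruct (sg x) as [y|Q] eqn:es; cbn.
      * do 2 eexists; repeat split; intros; eauto; now constructor.
      * right; do 2 eexists; repeat split; intros; eauto; now constructor.
    + left; do 2 eexists; repeat split; intros; now constructor.
  - rewrite ren_eE; destruct E; cbn in *; auto.
    + destruct IH as (G' & b' & -> & h1 & h2).
      do 2 eexists; repeat split; intros; constructor; auto.
    + destruct IH as (x' & Qs' & -> & h1 & h2).
      do 2 eexists; repeat split; intros; eauto; now constructor.
    + destruct IH as [(P' & Qs' & -> & h1 & h2)|(x' & Qs' & -> & h1 & h2)];
        [left|right]; do 2 eexists; repeat split; intros; try constructor; auto.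
Qed.

Lemma sim_sub_sound k : forall n,
  (forall E rho E' rho' st res, sim_sub_e E rho E' rho' ->
     neval k n E rho st res -> NEval k E' rho' st res) /\
  (forall c c' args args' st res, sim_sub c c' -> Forall2 sim_sub args args' ->
     ncall k n c args st res -> NCall k c' args' st res).
Proof.
  induction n as [|n [IHe IHc]]; (split; [intros E rho E' rho' st res sh ev|
    intros c c' args args' st res sc sa ev]); try (now inversion ev).
  - apply sim_sub_e_shape in sh; inversion ev; subst; cbn in sh.
    + subst; apply NEval_num.
    + destruct sh as (G' & b' & -> & h1 & h2); eapply NEval_case; eauto.
    + destruct sh as (G' & b' & -> & h1 & h2); eapply NEval_exn; eauto.
    + destruct sh as (x' & Qs' & -> & h1 & h2); apply NEval_var.
      eapply IHc; eauto. now apply nargs_sim.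
    + destruct sh as [(P' & Qs' & -> & h1 & h2)|(x' & Qs' & -> & h1 & h2)];
        [apply NEval_app|apply NEval_var]; (eapply IHc; eauto; now apply nargs_sim).
  - inversion ev; subst.
    + destruct (sim_sub_clo _ _ sc _ _ _ _ _ eq_refl sa) as (E' & rho' & -> & h); auto.
      apply NCall_clo; split; [apply Forall2_length in sa; congruence|eauto].
    + inversion sc; subst.
      inversion sa as [|? ? ? ? ? sa']; subst; inversion sa' as [|? ? ? ? ? sa'']; subst.
      inversion sa''; subst; exists 1; constructor.
    + inversion sc; subst.
      inversion sa as [|? ? ? ? ? sa']; subst; inversion sa' as [|? ? ? ? ? sa'']; subst.
      inversion sa''; subst; apply NCall_GS;
        (eapply IHc; eauto; constructor; [constructor|constructor]).
    + inversion sc; subst. inversion sa as [|? ? ? ? ? sa']; subst; inversion sa'; subst.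
      apply NCall_O; auto; eapply IHc; eauto.
      unfold ntok; destruct (_ <=? _); repeat constructor.
    + inversion sc; subst; inversion sa; subst; exists 1; constructor.
Qed.

Lemma NEval_beta k r Qs E rho st res :
  NEval k (subst_e (beta_env r Qs) E) rho st res ->
  NEval k E (next (nargs r Qs rho) rho) st res.
Proof.
  intros [n h]; eapply (proj1 (sim_sub_sound k n)); eauto.
  apply se_subst; unfold beta_env; intros i; destruct (Nat.ltb_spec i r); try discriminate.
  - intros j [= <-]. replace i with (i - r + length (nargs r Qs rho)) at 2
      by (rewrite nargs_length; lia).
    rewrite next_ge; apply sim_sub_refl.
  - intros Q [= <-]. rewrite (next_lt NG) by now rewrite nargs_length.
    rewrite nargs_length; unfold nargs.
    rewrite nth_indep with (d' := NC (Qs 0) rho) by (rewrite length_map, length_seq; lia).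
    rewrite (map_nth (fun j => NC (Qs j) rho)), seq_nth by lia. apply sim_sub_refl.
Qed.

Lemma NEval_app_env k q e rho args st res :
  NEval k (subst_e (app_env (length args) q) e) (next args rho) st res ->
  NEval k e (next (NC q rho :: args) rho) st res.
Proof.
  intros [n h]; eapply (proj1 (sim_sub_sound k n)); eauto; cbn.
  apply se_subst; unfold app_env; intros i;
    destruct (Nat.ltb_spec i (length args)); try discriminate;
    destruct (Nat.eqb_spec i (length args)) as [->|ne]; try discriminate.
  - lia.
  - intros j [= <-]; rewrite !(next_lt NG) by lia; apply sim_sub_refl.
  - intros j [= <-].
    replace (i - 1) with (i - 1 - length args + length args) by lia.
    replace i with (S (i - 1 - length args) + length args) at 2 by lia.
    rewrite !next_ge; apply sim_sub_refl.
  - intros Q [= <-]. pose proof (next_ge args (ncons (NC q rho) rho) 0) as e0; cbn in e0; rewrite e0.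
    apply ss_ren.
    replace (fun i => next args rho (i + length args)) with rho; [apply sim_sub_refl|].
    apply functional_extensionality; intros; now rewrite next_ge.
Qed.

(** * Evaluation and eta-expansion are invisible to the machine *)

Definition val_le_e (V T : mexpr) (K : stack) : Prop :=
  is_nsp_e V /\ forall t, fle_e t V -> apx t T K.

Definition val_le_p (P P' : mproc) : Prop :=
  match P, P' with MLam ts V, MLam ts' T => ts = ts' /\ val_le_e V T [] end.

Lemma nth_map_seq {A} (f : nat -> A) r j d : j < r -> nth j (map f (seq 0 r)) d = f j.
Proof.
  intros h; rewrite nth_indep with (d' := f 0) by (rewrite length_map, length_seq; lia).
  now rewrite map_nth, seq_nth.
Qed.

(** The approximant with trivial arguments and no branches forces a head form of the configuration.
    To reach one argument or one branch, an approximant of it is inserted while all others stay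
    trivial; by [hd_fun] all these approximants meet the same head form. *)
Lemma val_le_case x r Qs br T K : val_le_e (MCase (MVar x r Qs) br) T K ->
  exists Qs' b K', hd T K (HVar x r Qs' b K') /\
    (forall j, j < r -> val_le_p (Qs j) (Qs' j)) /\ (forall i, val_le_e (br i) (b i) K').
Proof.
  intros [nsp h]; inversion nsp as [| |? ? ? ? nq nb]; subst.
  set (bots := fun j => match Qs j with MLam ts _ => FLam ts FBot end).
  assert (lb : forall j, fle_p (bots j) (Qs j))
    by (intros j; unfold bots; destruct (Qs j); constructor; constructor).
  assert (h0 : apx (FCase x (map bots (seq 0 r)) []) T K).
  { apply h; constructor.
    - now rewrite length_map, length_seq.
    - intros j Hj; now rewrite nth_map_seq.
    - cbn; lia. }
  inversion h0 as [| |? ? ? ? ? r' Qs' b K' hh hl ha hb]; subst.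
  rewrite length_map, length_seq in *.
  exists Qs', b, K'; split; auto; split.
  - intros j Hj.
    assert (hq : forall q, fle_p q (Qs j) -> apxp q (Qs' j)).
    { intros q lq.
      assert (h1 : apx (FCase x (map (fun i => if i =? j then q else bots i) (seq 0 r)) []) T K).
      { apply h; constructor.
        - now rewrite length_map, length_seq.
        - intros i Hi; rewrite nth_map_seq by auto.
          destruct (Nat.eqb_spec i j); subst; auto.
        - cbn; lia. }
      inversion h1 as [| |? ? ? ? ? r1 Qs1 b1 K1 hh1 hl1 ha1 hb1]; subst.
      rewrite length_map, length_seq in *.
      pose proof (hd_fun _ _ _ hh _ hh1) as [= <- <- <-].
      specialize (ha1 j Hj); rewrite nth_map_seq in ha1 by auto.
      now rewrite Nat.eqb_refl in ha1. }
    specialize (nq j Hj); inversion nq as [ts e ne eq]; subst.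
    rewrite <- eq in hq.
    assert (h2 : apxp (FLam ts FBot) (Qs' j)) by (apply hq; repeat constructor).
    inversion h2 as [? ? E' _ eq1 eq2]; subst; cbn; repeat split; auto.
    intros t lt; specialize (hq (FLam ts t)); rewrite <- eq2 in hq.
    assert (h3 : apxp (FLam ts t) (MLam ts E')) by (apply hq; now constructor).
    now inversion h3.
  - intros i; split; [apply nb|]; intros t lt.
    assert (h1 : apx (FCase x (map bots (seq 0 r)) (repeat FBot i ++ [t])) T K).
    { apply h; constructor.
      - now rewrite length_map, length_seq.
      - intros j Hj; now rewrite nth_map_seq.
      - rewrite length_app, repeat_length; cbn; intros i' Hi'.
        destruct (Nat.eq_dec i' i) as [->|].
        + now rewrite app_nth2, repeat_length, Nat.sub_diag by (rewrite repeat_length; lia).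
        + rewrite app_nth1 by (rewrite repeat_length; lia).
          rewrite nth_repeat; constructor. }
    inversion h1 as [| |? ? ? ? ? r1 Qs1 b1 K1 hh1 hl1 ha1 hb1]; subst.
    rewrite length_map, length_seq in *.
    pose proof (hd_fun _ _ _ hh _ hh1) as [= <- <- <-].
    specialize (hb1 i); rewrite length_app, repeat_length in hb1; cbn in hb1.
    rewrite app_nth2, repeat_length, Nat.sub_diag in hb1 by (rewrite repeat_length; lia).
    apply hb1; lia.
Qed.

Lemma NEval_plug k rho st T T' :
  (forall res, NEval k T rho st res -> NEval k T' rho st res) ->
  forall K res, NEval k (plug T K) rho st res -> NEval k (plug T' K) rho st res.
Proof.
  intros h K; revert T T' h; induction K as [|b K IH]; cbn; auto.
  intros T T' h; apply IH; intros res h'.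
  apply NEval_case_inv in h' as [(m & h1 & h2)|[h1 h2]].
  - eapply NEval_case; eauto.
  - eapply NEval_exn; eauto.
Qed.

Lemma NEval_plug_case k rho st V K : forall b res,
  NEval k (MCase V (fun i => plug (b i) K)) rho st res ->
  NEval k (plug (MCase V b) K) rho st res.
Proof.
  induction K as [|b' K IH]; cbn; auto; intros b res h.
  apply (IH (fun i => MCase (b i) b')) in h.
  revert res h; apply NEval_plug; intros res h.
  apply NEval_case_inv in h as [(m & h1 & h2)|[h1 h2]].
  - apply NEval_case_inv in h2 as [(m' & h2 & h3)|[h2 h3]].
    + eapply NEval_case; eauto; eapply NEval_case; eauto.
    + apply NEval_exn; auto; eapply NEval_case; eauto.
  - apply NEval_exn; auto; apply NEval_exn; auto.
Qed.

Definition hnf_term (H : hnf) : mexpr :=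
  match H with
  | HNum n => MNum n
  | HVar x r Qs b K => MCase (MVar x r Qs) (fun i => plug (b i) K)
  end.

Lemma NEval_hd k rho st T K H : hd T K H -> forall res,
  NEval k (hnf_term H) rho st res -> NEval k (plug T K) rho st res.
Proof.
  induction 1; intros res h; auto.
  - cbn; apply NEval_plug with (T := b n); auto.
    intros; eapply NEval_case; eauto; apply NEval_num.
  - apply NEval_plug with (T := subst_e (beta_env r Qs) E); auto.
    intros res' h'; apply NEval_app, NCall_clo; split; [now rewrite nargs_length|].
    now apply NEval_beta.
  - cbn in *; now apply NEval_plug_case.
Qed.

(** Evaluation and eta-expansion share one relation because they mix along a run: calling an
    eta-expansion eta-expands the arguments, and these may in turn be handed to values. *)
Inductive sim_val : nclo -> nclo -> Prop :=
| sv_G : sim_val NG NG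
| sv_O s r : sim_val (NO s r) (NO s r)
| sv_cong P rho rho' : (forall i, sim_val (rho i) (rho' i)) -> sim_val (NC P rho) (NC P rho')
| sv_eta s x rho c' : sim_val (rho x) c' -> sim_val (NC (eta s x) rho) c'
| sv_val P P' rho rho' : val_le_p P P' -> (forall i, sim_val (rho i) (rho' i)) ->
    sim_val (NC P rho) (NC P' rho').

Lemma sim_val_refl c : sim_val c c.
Proof. induction c; constructor; auto. Qed.

Lemma Forall2_refl {A} (S : A -> A -> Prop) l : (forall a, S a a) -> Forall2 S l l.
Proof. intros h; induction l; constructor; auto. Qed.

Lemma Forall2_nth {A B} (S : A -> B -> Prop) l l' : Forall2 S l l' ->
  forall j d d', j < length l -> S (nth j l d) (nth j l' d').
Proof. induction 1; intros [|j] d d' h; cbn in *; try lia; auto; apply IHForall2; lia. Qed.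

Lemma sim_val_sound k : forall n,
  (forall E rho rho' st res, (forall i, sim_val (rho i) (rho' i)) ->
     neval k n E rho st res -> NEval k E rho' st res) /\
  (forall V T K rho rho' st res, val_le_e V T K -> (forall i, sim_val (rho i) (rho' i)) ->
     neval k n V rho st res -> NEval k (plug T K) rho' st res) /\
  (forall c c' args args' st res, sim_val c c' -> Forall2 sim_val args args' ->
     ncall k n c args st res -> NCall k c' args' st res).
Proof.
  induction n as [n IH] using lt_wf_ind; repeat split.
  - intros E rho rho' st res hr ev; inversion ev; subst;
      destruct (IH n0) as (IHe & _ & IHc); auto.
    + apply NEval_num.
    + eapply NEval_case; eauto.
    + eapply NEval_exn; eauto.
    + apply NEval_var; eapply IHc; eauto; apply nargs_sim; intros; now constructor.
    + apply NEval_app; eapply IHc; [|apply nargs_sim; intros|eassumption]; now constructor.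
  - intros V T K rho rho' st res vl hr ev; inversion ev as
      [n0 m|n0 G br ? ? m ? e1 e2|n0 G br ? ? ? e1 ne|n0 x r Qs ? ? ? e1|n0 P r Qs ? ? ? e1]; subst.
    + assert (a : apx (FNum m) T K) by (apply vl; constructor).
      inversion a; subst; eapply NEval_hd; eauto; apply NEval_num.
    + destruct vl as [nsp vl]; inversion nsp; subst.
      destruct (val_le_case _ _ _ _ _ _ (conj nsp vl)) as (Qs' & b & K' & hh & ha & hb).
      eapply NEval_hd; eauto; cbn.
      inversion e1; subst; eapply NEval_case.
      * apply NEval_var; eapply (IH n); eauto; apply nargs_sim; intros; apply sv_val; auto.
      * eapply (IH (S n)); eauto.
    + destruct vl as [nsp vl]; inversion nsp; subst.
      destruct (val_le_case _ _ _ _ _ _ (conj nsp vl)) as (Qs' & b & K' & hh & ha & hb).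
      eapply NEval_hd; eauto; cbn.
      inversion e1; subst; apply NEval_exn; auto.
      apply NEval_var; eapply (IH n); eauto; apply nargs_sim; intros; apply sv_val; auto.
    + destruct vl as [nsp _]; inversion nsp.
    + destruct vl as [nsp _]; inversion nsp.
  - intros c c' args args' st res sc sa ev.
    inversion sc as [|s r|P rho rho' hr|s x rho c1 hc|P P' rho rho' vl hr]; subst.
    + inversion ev; subst.
      * inversion sa as [|? ? ? ? ? sa']; subst; inversion sa' as [|? ? ? ? ? sa'']; subst.
        inversion sa''; subst; exists 1; constructor.
      * inversion sa as [|? ? ? ? ? sa']; subst; inversion sa' as [|? ? ? ? ? sa'']; subst.
        inversion sa''; subst; apply NCall_GS;
          (eapply (IH n0); eauto; constructor; [constructor|constructor]).
    + inversion ev; subst.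
      * inversion sa as [|? ? ? ? ? sa']; subst; inversion sa'; subst.
        apply NCall_O; auto; eapply (IH n0); eauto.
        unfold ntok; destruct (_ <=? _); repeat constructor.
      * inversion sa; subst; exists 1; constructor.
    + inversion ev; subst; apply NCall_clo; split; [apply Forall2_length in sa; congruence|].
      eapply (IH n0); eauto; now apply next_sim.
    + rewrite etaE in ev; inversion ev as [n0 ts E ? ? ? ? hl ev1| | | |]; subst.
      (* The identity [case] of an eta-expansion returns what its scrutinee returns. The call below
         it has a strictly smaller bound, so the induction hypothesis covers it even though its
         arguments are eta-expanded anew. *)
      assert (G : exists m, m < S n0 /\
        ncall k m (next args rho (x + length (argtys s)))
          (nargs (length (argtys s))
             (fun j => eta (nth j (argtys s) N) (length (argtys s) - 1 - j))
             (next args rho)) st res).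
      { inversion ev1 as [|n1 ? ? ? ? m ? e1 e2|n1 ? ? ? ? ? e1| |]; subst.
        - inversion e2; subst; inversion e1; subst; eexists; split; [|eassumption]; lia.
        - inversion e1; subst; eexists; split; [|eassumption]; lia. }
      destruct G as (m & Hm & e1).
      rewrite <- hl in e1; rewrite next_ge in e1; rewrite hl in e1.
      eapply (IH m); [exact Hm|exact hc| |exact e1].
      apply nargs_sim_l with (d := NG); [apply Forall2_length in sa; congruence|].
      intros j Hj; apply sv_eta. rewrite <- hl, next_nth with (d := NG) by lia.
      apply Forall2_nth; auto; lia.
    + destruct P as [ts V], P' as [ts' T]; destruct vl as [<- vl].
      inversion ev; subst; apply NCall_clo; split; [apply Forall2_length in sa; congruence|].
      eapply (IH n0) with (K := []); eauto; now apply next_sim.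
Qed.

Lemma NCall_eta k s x rho args st res :
  NCall k (NC (eta s x) rho) args st res -> NCall k (rho x) args st res.
Proof.
  intros [n h]; eapply (sim_val_sound k n); eauto.
  - apply sv_eta, sim_val_refl.
  - apply Forall2_refl, sim_val_refl.
Qed.

Lemma NCall_nsp_app k s ts e q rho args st res :
  NCall k (NC (nsp_app (MLam (s :: ts) e) q) rho) args st res ->
  NCall k (NC (MLam (s :: ts) e) rho) (NC q rho :: args) st res.
Proof.
  intros h; apply NCall_clo in h as [hl [n h]]; apply NCall_clo; split; [cbn; congruence|].
  apply NEval_app_env. rewrite hl.
  eapply (sim_val_sound k n) with (K := []); eauto; [exact (value_spec _)|].
  intros i; apply sim_val_refl.
Qed.

CoFixpoint nsp_eq_nsp_e e e' (h : nsp_eq_e e e') : is_nsp_e e'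
with nsp_eq_nsp_p p p' (h : nsp_eq_p p p') : is_nsp_p p'.
Proof.
  - destruct h as [|n|x r Qs Qs' br br' hq hb]; constructor.
    + intros j Hj; exact (nsp_eq_nsp_p _ _ (hq j Hj)).
    + intros i; exact (nsp_eq_nsp_e _ _ (hb i)).
  - destruct h; constructor; eauto.
Qed.

Lemma fle_nsp_eq :
  (forall t e', fle_e t e' -> forall e, nsp_eq_e e e' -> fle_e t e) /\
  (forall q p', fle_p q p' -> forall p, nsp_eq_p p p' -> fle_p q p).
Proof.
  apply fle_mutind; intros.
  - constructor.
  - inversion H; constructor.
  - inversion H4; subst; constructor; auto.
  - inversion H1; subst; constructor; auto.
Qed.

Lemma NCall_nsp_eq k p p' rho args st res : nsp_eq_p p p' ->
  NCall k (NC p' rho) args st res -> NCall k (NC p rho) args st res.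
Proof.
  intros eq [n h]; eapply (sim_val_sound k n); eauto; [|apply Forall2_refl, sim_val_refl].
  apply sv_val; [|intros; apply sim_val_refl].
  destruct eq as [ts e e' eq]; cbn; repeat split.
  - eapply nsp_eq_nsp_e; eauto.
  - intros t lt; apply (proj1 fle_apx); eapply (proj1 fle_nsp_eq); eauto.
Qed.

(** * Finite unfoldings of fixed points *)

Fixpoint FsigN (m : nat) (s : ty) (d : nat) : mproc :=
  MLam (argtys s)
    match m with
    | 0 => MBot
    | S m =>
      MCase (MVar (d + length (argtys s)) (S (length (argtys s)))
              (fun j => match j with
                        | 0 => FsigN m s (d + length (argtys s))
                        | S j' => eta (nth j' (argtys s) N) (length (argtys s) - 1 - j')
                        end))
           (fun i => MNum i)
    end.

(** The parameter bounds the length of the runs still to be simulated. Each unfolding costs at least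
    one step, so a run of length [n] cannot reach the [MBot] beneath [m >= n] unfoldings. This
    replaces an admissibility argument: facts on [Fsig] reduce to induction on [m]. *)
Inductive sim_unw (n : nat) : nclo -> nclo -> Prop :=
| su_G : sim_unw n NG NG
| su_O s r : sim_unw n (NO s r) (NO s r)
| su_cong P rho rho' : (forall i, sim_unw n (rho i) (rho' i)) -> sim_unw n (NC P rho) (NC P rho')
| su_F m s d rho rho' : n <= m -> (forall i, sim_unw n (rho i) (rho' i)) ->
    sim_unw n (NC (Fsig s d) rho) (NC (FsigN m s d) rho').

Lemma sim_unw_refl n c : sim_unw n c c.
Proof. induction c; constructor; auto. Qed.

Lemma sim_unw_le n n' c c' : n' <= n -> sim_unw n c c' -> sim_unw n' c c'.
Proof. intros l; induction 1; constructor; auto; lia. Qed.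

Lemma sim_unw_sound k : forall n,
  (forall E rho rho' st res, (forall i, sim_unw n (rho i) (rho' i)) ->
     neval k n E rho st res -> NEval k E rho' st res) /\
  (forall c c' args args' st res, sim_unw n c c' -> Forall2 (sim_unw n) args args' ->
     ncall k n c args st res -> NCall k c' args' st res).
Proof.
  assert (LE : forall n n' l l', n' <= n -> Forall2 (sim_unw n) l l' -> Forall2 (sim_unw n') l l').
  { intros; eapply Forall2_impl; [|eassumption]; intros; eapply sim_unw_le; eauto. }
  induction n as [n IH] using lt_wf_ind; split.
  - intros E rho rho' st res hr ev; inversion ev; subst;
      destruct (IH n0) as (IHe & IHc); auto;
      assert (hr' : forall i, sim_unw n0 (rho i) (rho' i))
        by (intros; eapply sim_unw_le; [|apply hr]; lia).
    + apply NEval_num.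
    + eapply NEval_case; eauto.
    + eapply NEval_exn; eauto.
    + apply NEval_var; eapply IHc; eauto; apply nargs_sim; intros; now constructor.
    + apply NEval_app; eapply IHc; [|apply nargs_sim; intros|eassumption]; now constructor.
  - intros c c' args args' st res sc sa ev.
    inversion sc as [|s r|P rho rho' hr|m s d rho rho' hm hr]; subst.
    + inversion ev; subst.
      * inversion sa as [|? ? ? ? ? sa']; subst; inversion sa' as [|? ? ? ? ? sa'']; subst.
        inversion sa''; subst; exists 1; constructor.
      * inversion sa as [|? ? ? ? ? sa']; subst; inversion sa' as [|? ? ? ? ? sa'']; subst.
        inversion sa''; subst; apply NCall_GS;
          (eapply (IH n0); eauto; [eapply sim_unw_le; [|eassumption]; lia|];
           constructor; [constructor|constructor]).
    + inversion ev; subst.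
      * inversion sa as [|? ? ? ? ? sa']; subst; inversion sa'; subst.
        apply NCall_O; auto; eapply (IH n0); eauto; [eapply sim_unw_le; [|eassumption]; lia|].
        unfold ntok; destruct (_ <=? _); repeat constructor.
      * inversion sa; subst; exists 1; constructor.
    + inversion ev; subst; apply NCall_clo; split; [apply Forall2_length in sa; congruence|].
      eapply (IH n0); eauto; apply next_sim; [eapply LE; [|eassumption]; lia|].
      intros; eapply sim_unw_le; [|apply hr]; lia.
    + rewrite FsigE in ev; inversion ev as [n0 ts E ? ? ? ? hl ev1| | | |]; subst.
      assert (nx : forall i, sim_unw (S n0) (next args rho i) (next args' rho' i))
        by now apply next_sim.
      destruct m as [|m]; [lia|]; cbn; apply NCall_clo; split;
        [apply Forall2_length in sa; congruence|apply NEval_id, NEval_var].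
      assert (G : exists m, m < n0 /\
        ncall k m (next args rho (d + length (argtys s)))
          (nargs (S (length (argtys s)))
             (fun j => match j with
                       | 0 => Fsig s (d + length (argtys s))
                       | S j' => eta (nth j' (argtys s) N) (length (argtys s) - 1 - j')
                       end) (next args rho)) st res).
      { inversion ev1 as [|n1 ? ? ? ? m1 ? e1 e2|n1 ? ? ? ? ? e1| |]; subst.
        - inversion e2; subst; inversion e1; subst; eexists; split; [|eassumption]; lia.
        - inversion e1; subst; eexists; split; [|eassumption]; lia. }
      destruct G as (n1 & Hn & e1).
      eapply (IH n1); [lia| | |exact e1].
      * eapply sim_unw_le; [|apply nx]; lia.
      * apply nargs_sim; intros [|j] Hj; constructor; try lia;
          intros; (eapply sim_unw_le; [|apply nx]; lia).
Qed.

Lemma NCall_unwind k s d rho args st res :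
  NCall k (NC (Fsig s d) rho) args st res ->
  exists m, NCall k (NC (FsigN m s d) rho) args st res.
Proof.
  intros [n h]; exists n; eapply (sim_unw_sound k n); eauto.
  - constructor; auto; intros; apply sim_unw_refl.
  - apply Forall2_refl, sim_unw_refl.
Qed.

(** * Long normal forms with recursive definitions *)

(* Variables are named, so that weakening of contexts is the identity.  The
   [j]-th argument in [BVar x r ps bs] is the abstraction of [bs j] over [ps j];
   [BRec f ps F b] is [letrec f = fun ps => F in b]. *)
Inductive body : Type :=
| BNum (n : nat)
| BC (f : nat -> option nat) (b : body)
| BIfz (b b1 b2 : body)
| BVar (x r : nat) (ps : nat -> list (nat * ty)) (bs : nat -> body)
| BRec (f : nat) (ps : list (nat * ty)) (F b : body).

Inductive clo : Type :=
| Cl (ps : list (nat * ty)) (b : body) (rho : cenv)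
| CG
| CO (s r : nat)
with cenv : Type :=
| ENil
| ECons (x : nat) (c : clo) (rho : cenv)
| ERec (f : nat) (ps : list (nat * ty)) (F : body) (rho : cenv).

Fixpoint lookup (rho : cenv) (x : nat) : option clo :=
  match rho with
  | ENil => None
  | ECons y c rho' => if x =? y then Some c else lookup rho' x
  | ERec f ps F rho' => if x =? f then Some (Cl ps F rho) else lookup rho' x
  end.

Fixpoint extenv (ps : list (nat * ty)) (args : list clo) (rho : cenv) : cenv :=
  match ps, args with
  | (x, _) :: ps, a :: args => extenv ps args (ECons x a rho)
  | _, _ => rho
  end.

Definition cargs r (ps : nat -> list (nat * ty)) (bs : nat -> body) (rho : cenv) : list clo :=
  map (fun j => Cl (ps j) (bs j) rho) (seq 0 r).

Definition ctok (k s r : nat) : list clo := if s <=? k then [CO s r] else [].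

Inductive eval (k : nat) : nat -> body -> cenv -> state -> result -> Prop :=
| ev_num n m rho st : eval k (S n) (BNum m) rho st (RNum m)
| ev_C n f b rho st m m' : eval k n b rho st (RNum m) -> f m = Some m' ->
    eval k (S n) (BC f b) rho st (RNum m')
| ev_C_exn n f b rho st res : eval k n b rho st res -> (forall m, res <> RNum m) ->
    eval k (S n) (BC f b) rho st res
| ev_ifz n b b1 b2 rho st m res : eval k n b rho st (RNum m) ->
    eval k n (match m with 0 => b1 | S _ => b2 end) rho st res ->
    eval k (S n) (BIfz b b1 b2) rho st res
| ev_ifz_exn n b b1 b2 rho st res : eval k n b rho st res -> (forall m, res <> RNum m) ->
    eval k (S n) (BIfz b b1 b2) rho st res
| ev_var n x r ps bs rho st res c : lookup rho x = Some c ->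
    call k n c (cargs r ps bs rho) st res -> eval k (S n) (BVar x r ps bs) rho st res
| ev_rec n f ps F b rho st res : eval k n b (ERec f ps F rho) st res ->
    eval k (S n) (BRec f ps F b) rho st res
with call (k : nat) : nat -> clo -> list clo -> state -> result -> Prop :=
| ca_clo n ps b rho args st res : length args = length ps ->
    eval k n b (extenv ps args rho) st res -> call k (S n) (Cl ps b rho) args st res
| ca_G0 n F e : call k (S n) CG [F; e] (Idle 0) RWin
| ca_GS n F e r : call k n e [CO 1 (S r)] (Test (S r) 0) ROk ->
    call k n F [CO 0 r] (Idle r) RWin -> call k (S n) CG [F; e] (Idle (S r)) RWin
| ca_O n s r W : s < k -> call k n W (ctok k (S (S s)) r) (Test r (S s)) ROk ->
    call k (S n) (CO s r) [W] (Test r s) ROk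
| ca_Ok n r : call k (S n) (CO k r) [] (Test r k) ROk.

Scheme eval_mind := Minimality for eval Sort Prop
with call_mind := Minimality for call Sort Prop.
Combined Scheme ev_mutind from eval_mind, call_mind.

Definition Eval k b rho st res := exists n, eval k n b rho st res.
Definition Call k c args st res := exists n, call k n c args st res.

Lemma ev_mono k :
  (forall n b rho st res, eval k n b rho st res ->
     forall n', n <= n' -> eval k n' b rho st res) /\
  (forall n c args st res, call k n c args st res ->
     forall n', n <= n' -> call k n' c args st res).
Proof.
  apply ev_mutind; intros; destruct n' as [|n']; try lia;
    econstructor; solve [eauto | match goal with h : forall _, _ -> _ |- _ => apply h; lia end].
Qed.

Lemma Eval_C k f b rho st res :
  (exists m m', Eval k b rho st (RNum m) /\ f m = Some m' /\ res = RNum m') \/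
  (Eval k b rho st res /\ forall m, res <> RNum m) ->
  Eval k (BC f b) rho st res.
Proof.
  intros [(m & m' & [n h] & e & ->)|[[n h] e]]; exists (S n);
    [eapply ev_C|eapply ev_C_exn]; eauto.
Qed.

Lemma Eval_ifz k b b1 b2 rho st m res : Eval k b rho st (RNum m) ->
  Eval k (match m with 0 => b1 | S _ => b2 end) rho st res -> Eval k (BIfz b b1 b2) rho st res.
Proof.
  intros [n h] [n' h']; exists (S (max n n')); econstructor;
    eapply (proj1 (ev_mono k)); eauto; lia.
Qed.

Lemma Eval_ifz_exn k b b1 b2 rho st res : Eval k b rho st res -> (forall m, res <> RNum m) ->
  Eval k (BIfz b b1 b2) rho st res.
Proof. intros [n h] h'; exists (S n); now apply ev_ifz_exn. Qed.

Lemma Eval_var k x r ps bs rho st res c : lookup rho x = Some c ->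
  Call k c (cargs r ps bs rho) st res -> Eval k (BVar x r ps bs) rho st res.
Proof. intros h [n h']; exists (S n); econstructor; eauto. Qed.

Lemma Eval_rec k f ps F b rho st res : Eval k b (ERec f ps F rho) st res ->
  Eval k (BRec f ps F b) rho st res.
Proof. intros [n h]; exists (S n); now constructor. Qed.

Lemma Call_clo k ps b rho args st res : length args = length ps ->
  Eval k b (extenv ps args rho) st res -> Call k (Cl ps b rho) args st res.
Proof. intros h [n h']; exists (S n); now constructor. Qed.

Lemma Call_clo_cons k x s ps b rho a args st res :
  Call k (Cl ps b (ECons x a rho)) args st res ->
  Call k (Cl ((x, s) :: ps) b rho) (a :: args) st res.
Proof.
  intros [n h]; inversion h; subst; eexists; constructor; cbn; eauto.
Qed.

Lemma Call_GS k F e r : Call k e [CO 1 (S r)] (Test (S r) 0) ROk ->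
  Call k F [CO 0 r] (Idle r) RWin -> Call k CG [F; e] (Idle (S r)) RWin.
Proof.
  intros [a ha] [b hb]; exists (S (max a b)); constructor;
    eapply (proj2 (ev_mono k)); eauto; lia.
Qed.

Definition ctx := list (nat * ty).

Fixpoint clookup (G : ctx) (x : nat) : option ty :=
  match G with [] => None | (y, s) :: G => if x =? y then Some s else clookup G x end.

Fixpoint extctx (ps : list (nat * ty)) (G : ctx) : ctx :=
  match ps with [] => G | p :: ps => extctx ps (p :: G) end.

Definition subctx (G G' : ctx) : Prop :=
  forall x s, clookup G x = Some s -> clookup G' x = Some s.

(** Bodies have ground type and variables are fully applied, so normal forms are eta-long. The bound
    [lv s <= k] in [wt_rec] is where the restriction on fixed points enters the combinatorial
    part. *)
Inductive wt (k : nat) : ctx -> body -> Prop :=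
| wt_num G n : wt k G (BNum n)
| wt_C G f b : wt k G b -> wt k G (BC f b)
| wt_ifz G b b1 b2 : wt k G b -> wt k G b1 -> wt k G b2 -> wt k G (BIfz b b1 b2)
| wt_var G x s r ps bs : clookup G x = Some s -> length (argtys s) = r ->
    (forall j, j < r -> map snd (ps j) = argtys (nth j (argtys s) N)) ->
    (forall j, j < r -> wt k (extctx (ps j) G) (bs j)) -> wt k G (BVar x r ps bs)
| wt_rec G f s ps F b : lv s <= k -> map snd ps = argtys s ->
    wt k (extctx ps ((f, s) :: G)) F -> wt k ((f, s) :: G) b -> wt k G (BRec f ps F b).

Lemma subctx_refl G : subctx G G.  Proof. now intros x s. Qed.
Lemma subctx_trans G G' G'' : subctx G G' -> subctx G' G'' -> subctx G G''.
Proof. intros h h' x s e; auto. Qed.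
Lemma subctx_cons p G G' : subctx G G' -> subctx (p :: G) (p :: G').
Proof. intros h x s; destruct p as [y t]; cbn; destruct (x =? y); auto. Qed.
Lemma subctx_ext ps : forall G G', subctx G G' -> subctx (extctx ps G) (extctx ps G').
Proof. induction ps as [|p ps IH]; cbn; auto; intros; now apply IH, subctx_cons. Qed.
Lemma subctx_fresh G x s : clookup G x = None -> subctx G ((x, s) :: G).
Proof. intros h y t e; cbn; destruct (Nat.eqb_spec y x); subst; congruence. Qed.

Lemma wt_sub k G b : wt k G b -> forall G', subctx G G' -> wt k G' b.
Proof.
  induction 1; intros G' h; econstructor; eauto using subctx_cons, subctx_ext.
Qed.

Lemma fresh_name (G : ctx) : exists x, clookup G x = None.
Proof.
  assert (h : exists m, forall x, m <= x -> clookup G x = None).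
  { induction G as [|[y s] G [m IH]]; [now exists 0|].
    exists (max (S y) m); intros x Hx; cbn; destruct (Nat.eqb_spec x y); [lia|].
    apply IH; lia. }
  destruct h as [m h]; exists m; auto.
Qed.

(** * Relating procedures to normal forms *)

(** A logical relation whose base case transports runs from procedures to normal forms. Arguments
    accumulate in lists because a closure can be called only on its complete block of arguments. *)
Fixpoint Rel (k : nat) (s : ty) (c : nclo) (l : list nclo) (c' : clo) (l' : list clo) : Prop :=
  match s with
  | N => forall st res, NCall k c l st res -> Call k c' l' st res
  | Arr s t => forall a a', Rel k s a [] a' [] -> Rel k t c (l ++ [a]) c' (l' ++ [a'])
  end.

Inductive RelArgs (k : nat) : list ty -> list nclo -> list clo -> Prop :=
| ra_nil : RelArgs k [] [] []
| ra_cons s ss a l a' l' : Rel k s a [] a' [] -> RelArgs k ss l l' ->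
    RelArgs k (s :: ss) (a :: l) (a' :: l').

Lemma Rel_elim k s : forall c l c' l' a a' st res, Rel k s c l c' l' ->
  RelArgs k (argtys s) a a' -> NCall k c (l ++ a) st res -> Call k c' (l' ++ a') st res.
Proof.
  induction s as [|s _ t IH]; cbn; intros c l c' l' a a' st res h ha hc.
  - inversion ha; subst; rewrite app_nil_r in *; auto.
  - inversion ha as [|? ? b m b' m' h1 h2]; subst.
    specialize (IH c (l ++ [b]) c' (l' ++ [b']) m m' st res).
    rewrite <- !app_assoc in IH; apply IH; auto.
Qed.

Lemma Rel_intro k s : forall c l c' l',
  (forall a a' st res, RelArgs k (argtys s) a a' ->
     NCall k c (l ++ a) st res -> Call k c' (l' ++ a') st res) -> Rel k s c l c' l'.
Proof.
  induction s as [|s _ t IH]; cbn; intros c l c' l' h.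
  - intros st res hc; specialize (h [] [] st res); rewrite !app_nil_r in h.
    apply h; auto; constructor.
  - intros a a' ha; apply IH; intros b b' st res hb; rewrite <- !app_assoc; apply h.
    now constructor.
Qed.

Lemma RelArgs_length k ss a a' : RelArgs k ss a a' ->
  length a = length ss /\ length a' = length ss.
Proof. induction 1; cbn; lia. Qed.

Lemma RelArgs_nth k ss a a' : RelArgs k ss a a' -> forall j d d', j < length ss ->
  Rel k (nth j ss N) (nth j a d) [] (nth j a' d') [].
Proof. induction 1; intros [|j] d d' h; cbn in *; try lia; auto; apply IHRelArgs; lia. Qed.

Lemma RelArgs_intro k ss : forall a a', length a = length ss -> length a' = length ss ->
  (forall j, j < length ss -> Rel k (nth j ss N) (nth j a NG) [] (nth j a' CG) []) ->
  RelArgs k ss a a'.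
Proof.
  induction ss as [|s ss IH]; intros [|x a] [|x' a'] h h' H; cbn in *; try lia; constructor.
  - apply (H 0); lia.
  - apply IH; try lia; intros j Hj; apply (H (S j)); lia.
Qed.

Lemma Rel_src k s c l c1 l1 c' l' :
  (forall a st res, NCall k c (l ++ a) st res -> NCall k c1 (l1 ++ a) st res) ->
  Rel k s c1 l1 c' l' -> Rel k s c l c' l'.
Proof.
  intros h h1; apply Rel_intro; intros a a' st res ha hc.
  eapply Rel_elim; eauto.
Qed.

Lemma Rel_tgt k s c l c' l' c1 l1 :
  (forall a st res, Call k c1 (l1 ++ a) st res -> Call k c' (l' ++ a) st res) ->
  Rel k s c l c1 l1 -> Rel k s c l c' l'.
Proof.
  intros h h1; apply Rel_intro; intros a a' st res ha hc; apply h.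
  eapply Rel_elim; eauto.
Qed.

Lemma Rel_eta k s x rho c' : Rel k s (rho x) [] c' [] -> Rel k s (NC (eta s x) rho) [] c' [].
Proof. apply Rel_src; intros a st res; apply NCall_eta. Qed.

Definition val := nat -> nclo.

Definition RelCtx (k : nat) (G : ctx) (v : val) (rho : cenv) : Prop :=
  forall x s, clookup G x = Some s ->
    exists c, lookup rho x = Some c /\ Rel k s (v x) [] c [].

Definition upd (v : val) (x : nat) (a : nclo) : val := fun y => if y =? x then a else v y.

Lemma RelCtx_sub k G G' v rho : subctx G G' -> RelCtx k G' v rho -> RelCtx k G v rho.
Proof. intros h h' x s e; apply h'; auto. Qed.

Lemma RelCtx_cons k G v rho x s a a' : clookup G x = None -> RelCtx k G v rho ->
  Rel k s a [] a' [] -> RelCtx k ((x, s) :: G) (upd v x a) (ECons x a' rho).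
Proof.
  intros f h ha y t; cbn; unfold upd; destruct (Nat.eqb_spec y x); subst; auto.
  intros [= <-]; eauto.
Qed.

Lemma RelCtx_rec k G v rho f s a ps F : clookup G f = None -> RelCtx k G v rho ->
  Rel k s a [] (Cl ps F (ERec f ps F rho)) [] ->
  RelCtx k ((f, s) :: G) (upd v f a) (ERec f ps F rho).
Proof.
  intros fr h ha y t; cbn; unfold upd; destruct (Nat.eqb_spec y f); subst; auto.
  intros [= <-]; eauto.
Qed.

(** * Normalisation by evaluation *)

Definition loc {A} (G : ctx) (Q : val -> A) : Prop :=
  forall v v', (forall x s, clookup G x = Some s -> v x = v' x) -> Q v = Q v'.

Lemma loc_sub {A} G G' (Q : val -> A) : subctx G G' -> loc G Q -> loc G' Q.
Proof. intros h l v v' e; apply l; eauto. Qed.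

Lemma loc_upd {A} G (Q : val -> A) v x a : clookup G x = None -> loc G Q -> Q (upd v x a) = Q v.
Proof.
  intros f l; apply l; intros y s e; unfold upd; destruct (Nat.eqb_spec y x); auto; congruence.
Qed.

(** The normal form is chosen before the valuation: one body has to serve all related environments,
    in particular tokens of every round number. *)
Definition RedN (k : nat) (G : ctx) (c : val -> nclo) (l : val -> list nclo) : Prop :=
  exists b, wt k G b /\ forall v rho, RelCtx k G v rho ->
    forall st res, NCall k (c v) (l v) st res -> Eval k b rho st res.

(** A Kripke predicate over extensions of the context, so that reification can supply fresh names as
    arguments. *)
Fixpoint Red (k : nat) (s : ty) (G : ctx) (c : val -> nclo) (l : val -> list nclo) : Prop :=
  match s with
  | N => RedN k G c l
  | Arr s t => forall G' Q, subctx G G' -> loc G' Q -> Red k s G' Q (fun _ => []) ->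
      Red k t G' c (fun v => l v ++ [Q v])
  end.

Definition RedArgs (k : nat) (G : ctx) (ss : list ty) (Qs : list (val -> nclo)) : Prop :=
  Forall2 (fun s Q => loc G Q /\ Red k s G Q (fun _ => [])) ss Qs.

Lemma Red_sub k s G G' c l : subctx G G' -> Red k s G c l -> Red k s G' c l.
Proof.
  intros h; destruct s as [|s t]; cbn.
  - intros (b & hb & H); exists b; split; [now apply wt_sub with G|].
    intros v rho hv; apply H; now apply RelCtx_sub with G'.
  - intros H G1 Q h1; apply H; eapply subctx_trans; eauto.
Qed.

Lemma RedN_src k G c l c1 l1 :
  (forall v st res, NCall k (c v) (l v) st res -> NCall k (c1 v) (l1 v) st res) ->
  RedN k G c1 l1 -> RedN k G c l.
Proof. intros h (b & hb & H); exists b; split; eauto. Qed.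

Lemma Red_src k s : forall G c l c1 l1,
  (forall v a st res, NCall k (c v) (l v ++ a) st res -> NCall k (c1 v) (l1 v ++ a) st res) ->
  Red k s G c1 l1 -> Red k s G c l.
Proof.
  induction s as [|s _ t IH]; cbn; intros G c l c1 l1 h.
  - apply RedN_src; intros v st res hc; specialize (h v [] st res).
    rewrite !app_nil_r in h; auto.
  - intros H G' Q h1 h2 h3; eapply IH; [|exact (H G' Q h1 h2 h3)].
    intros v a st res; rewrite <- !app_assoc; apply h.
Qed.

Lemma RedArgs_sub k G G' ss Qs : subctx G G' -> RedArgs k G ss Qs -> RedArgs k G' ss Qs.
Proof.
  intros h; apply Forall2_impl; intros s Q [h1 h2]; split;
    [eapply loc_sub|eapply Red_sub]; eauto.
Qed.

Lemma Red_intro k s : forall G c l,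
  (forall G' Qs, subctx G G' -> RedArgs k G' (argtys s) Qs ->
     RedN k G' c (fun v => l v ++ map (fun Q => Q v) Qs)) -> Red k s G c l.
Proof.
  induction s as [|s _ t IH]; cbn; intros G c l h.
  - eapply RedN_src; [|apply (h G []); [apply subctx_refl|constructor]].
    intros v st res; cbn; now rewrite app_nil_r.
  - intros G' Q h1 h2 h3; apply IH; intros G1 Qs h4 h5.
    eapply RedN_src; [|apply (h G1 (Q :: Qs)); [eapply subctx_trans; eauto|]].
    + intros v st res; cbn; now rewrite <- app_assoc.
    + constructor; auto; split; [eapply loc_sub|eapply Red_sub]; eauto.
Qed.

Definition reifies (k : nat) (s : ty) : Prop :=
  forall G c l, loc G c -> loc G l -> Red k s G c l ->
  exists ps b, map snd ps = argtys s /\ wt k (extctx ps G) b /\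
    forall v rho, RelCtx k G v rho -> Rel k s (c v) (l v) (Cl ps b rho) [].

Lemma reify_args k G ss Qs : Forall (reifies k) ss -> RedArgs k G ss Qs ->
  exists ps bs,
    (forall j, j < length ss -> map snd (ps j) = argtys (nth j ss N)) /\
    (forall j, j < length ss -> wt k (extctx (ps j) G) (bs j)) /\
    forall v rho, RelCtx k G v rho ->
      RelArgs k ss (map (fun Q => Q v) Qs) (cargs (length ss) ps bs rho).
Proof.
  intros hr ha; induction ha as [|s Q ss Qs [h1 h2] ha IH].
  - exists (fun _ => []), (fun _ => BNum 0); cbn; repeat split; try lia.
    intros; constructor.
  - inversion hr as [|? ? r1 r2]; subst; destruct (IH r2) as (ps & bs & e1 & e2 & e3).
    destruct (r1 G Q (fun _ => [])) as (p & b & e4 & e5 & e6); auto.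
    { now intros v v'. }
    exists (fun j => match j with 0 => p | S j => ps j end),
           (fun j => match j with 0 => b | S j => bs j end).
    repeat split; cbn.
    + intros [|j] Hj; auto; apply e1; lia.
    + intros [|j] Hj; auto; apply e2; lia.
    + intros v rho hv; unfold cargs; cbn; rewrite <- seq_shift, map_map; constructor; auto.
      now apply e3.
Qed.

(** Reflecting a name needs its arguments reified; reifying at an arrow type reflects a fresh name
    at the domain and reifies at the codomain. Since [BVar] takes all its arguments at once, the
    induction also carries reification for every type in [argtys s]. *)
Lemma reflect_reify k s :
  (forall G x, clookup G x = Some s -> Red k s G (fun v => v x) (fun _ => [])) /\
  reifies k s /\ Forall (reifies k) (argtys s).
Proof.
  assert (refl : forall s, Forall (reifies k) (argtys s) ->
    forall G x, clookup G x = Some s -> Red k s G (fun v => v x) (fun _ => [])).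
  { clear s; intros s hr G x hx; apply Red_intro; intros G' Qs h ha; cbn.
    destruct (reify_args _ _ _ _ hr ha) as (ps & bs & e1 & e2 & e3).
    exists (BVar x (length (argtys s)) ps bs); split.
    - econstructor; eauto.
    - intros v rho hv st res hc; destruct (hv x s) as (c & e & hrel); auto.
      eapply Eval_var; eauto; now apply (Rel_elim k s (v x) [] c [] _ _ _ _ hrel (e3 v rho hv)). }
  induction s as [|s (IH1 & IH2 & _) t (_ & IH3 & IH4)]; cbn.
  - repeat split; auto.
    + intros G x hx; apply (refl N); auto; constructor.
    + intros G c l hc hl (b & hb & H); exists [], b; repeat split; auto.
      intros v rho hv st res h; apply Call_clo; auto; cbn; eauto.
  - assert (H : Forall (reifies k) (argtys (Arr s t))) by (cbn; auto).
    split; [apply (refl (Arr s t)); auto|split; auto].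
    intros G c l hc hl hred; destruct (fresh_name G) as [x fr].
    assert (sb := subctx_fresh G x s fr).
    destruct (IH3 ((x, s) :: G) c (fun v => l v ++ [v x])) as (ps & b & e1 & e2 & e3).
    + eapply loc_sub; eauto.
    + intros v v' e; f_equal; [now eapply (loc_sub _ _ _ sb hl)|].
      f_equal; apply (e x s); cbn; now rewrite Nat.eqb_refl.
    + apply hred; auto.
      * intros v v' e; apply (e x s); cbn; now rewrite Nat.eqb_refl.
      * apply IH1; cbn; now rewrite Nat.eqb_refl.
    + exists ((x, s) :: ps), b; cbn; repeat split; auto; [now f_equal|].
      intros v rho hv a a' ha.
      specialize (e3 _ _ (RelCtx_cons _ _ _ _ _ _ _ _ fr hv ha)).
      rewrite (loc_upd _ _ _ _ _ fr hc), (loc_upd _ _ _ _ _ fr hl) in e3.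
      unfold upd at 1 in e3; rewrite Nat.eqb_refl in e3.
      eapply Rel_tgt; [|exact e3]; intros a1 st res; cbn; apply Call_clo_cons.
Qed.

(** Strong induction on the level: a call of token [s] makes the opponent call the argument on token
    [S (S s)], whose type is two levels lower. *)
Lemma Rel_tok k r s : s <= k -> Rel k (pure (k - s)) (NO s r) [] (CO s r) [].
Proof.
  remember (k - s) as j eqn:ej; revert s ej.
  induction j as [j IH] using lt_wf_ind; intros s ej hs.
  apply Rel_intro; intros a a' st res ha [n h]; cbn in *.
  inversion h as [| | |n0 ? ? W hs' h'|]; subst.
  - destruct (k - s) as [|j] eqn:ej; [lia|].
    inversion ha as [|? ? ? ? W' ? hW ha']; subst; inversion ha'; subst.
    assert (h1 : Call k W' (ctok k (S (S s)) r) (Test r (S s)) ROk).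
    { apply (Rel_elim k (pure j) W [] W' [] (ntok k (S (S s)) r)); auto; [|eexists; eauto].
      unfold ntok, ctok; destruct (Nat.leb_spec (S (S s)) k).
      - destruct j as [|j]; [lia|]; constructor; [|constructor].
        apply IH; lia.
      - replace j with 0 by lia; constructor. }
    destruct h1 as [m h1]; exists (S m); now constructor.
  - rewrite Nat.sub_diag in ha; inversion ha; subst; exists 1; constructor.
Qed.

Definition gty (k : nat) : ty := Arr (pure (S k)) (pure (S k)).

Lemma Rel_G k : 1 <= k -> Rel k (gty k) NG [] CG [].
Proof.
  intros hk; apply Rel_intro; intros a a' st res ha [n h]; cbn [gty argtys pure app] in *.
  inversion ha as [|? ? F ? F' ? hF ha1]; subst.
  inversion ha1 as [|? ? e ? e' ? he ha2]; subst; inversion ha2; subst.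
  inversion h as [|n0|n0 ? ? r h1 h2| |]; subst.
  - exists 1; constructor.
  - apply Call_GS.
    + destruct k as [|k]; [lia|].
      apply (Rel_elim _ (pure (S k)) e [] e' [] [NO 1 (S r)] [CO 1 (S r)]); auto;
        [|eexists; eauto].
      constructor; [|constructor]. pose proof (Rel_tok (S k) (S r) 1) as ht.
      cbn in ht; rewrite Nat.sub_0_r in ht; apply ht; lia.
    + apply (Rel_elim _ (pure (S k)) F [] F' [] [NO 0 r] [CO 0 r]); auto; [|eexists; eauto].
      constructor; [|constructor]. pose proof (Rel_tok k r 0) as ht.
      rewrite Nat.sub_0_r in ht; apply ht; lia.
Qed.

Lemma den_shape G M s : has_type G M s -> exists e, den G M = MLam (argtys s) e.
Proof.
  induction 1; cbn; try (eexists; reflexivity).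
  - rewrite (nth_error_nth _ _ _ H), etaE; eauto.
  - destruct IHhas_type as [e ->]; cbn; eauto.
  - destruct IHhas_type1 as [e ->]; cbn; eauto.
Qed.

Lemma NCall_merge k s p rho a args st res :
  NCall k (NC (lam_merge s p) rho) (a :: args) st res ->
  NCall k (NC p (ncons a rho)) args st res.
Proof.
  destruct p as [ts e]; cbn; intros h; apply NCall_clo in h as [hl h]; apply NCall_clo.
  split; [now injection hl|exact h].
Qed.

Lemma Red_C k G f rho : Red k (Arr N N) G (fun v => NC (den_C f) (rho v)) (fun _ => []).
Proof.
  intros G' Q _ _ (b & hb & H); exists (BC f b); split; [now constructor|].
  intros v c hv st res h; cbn in h; apply NCall_clo in h as [_ h].
  apply Eval_C; apply NEval_case_inv in h as [(m & h1 & h2)|[h1 h2]].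
  - left; apply NEval_var in h1; cbn in h1; exists m.
    destruct (f m) as [m'|]; destruct h2 as [n h2]; inversion h2; subst; eauto.
  - right; apply NEval_var in h1; split; eauto.
Qed.

Lemma Red_ifz k G rho :
  Red k (Arr N (Arr N (Arr N N))) G (fun v => NC den_ifz (rho v)) (fun _ => []).
Proof.
  apply Red_intro; intros G' Qs _ ha; cbn in ha.
  inversion ha as [|? Q1 ? ? [_ r1] ha1]; subst.
  inversion ha1 as [|? Q2 ? ? [_ r2] ha2]; subst.
  inversion ha2 as [|? Q3 ? ? [_ r3] ha3]; subst; inversion ha3; subst.
  destruct r1 as (b1 & w1 & H1), r2 as (b2 & w2 & H2), r3 as (b3 & w3 & H3).
  exists (BIfz b1 b2 b3); split; [now constructor|].
  intros v c hv st res h; cbn in h; apply NCall_clo in h as [_ h]; cbn in h.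
  apply NEval_case_inv in h as [(m & h1 & h2)|[h1 h2]]; apply NEval_var in h1; cbn in h1.
  - apply Eval_ifz with m; eauto.
    destruct m; apply NEval_id, NEval_var in h2; cbn in h2; eauto.
  - apply Eval_ifz_exn; eauto.
Qed.

(* The hypothesis says that [c] is a recursive definition whose body simulates
   one unfolding of the fixed point of [q]. *)
Lemma Rel_FsigN k s q c : (forall a, Rel k s a [] c [] -> Rel k s q [a] c []) ->
  forall m d rho, rho d = q -> Rel k s (NC (FsigN m s d) rho) [] c [].
Proof.
  intros hq; induction m as [|m IH]; intros d rho hd; apply Rel_intro;
    intros a a' st res ha h; cbn in h; apply NCall_clo in h as [hl h].
  - destruct h as [n h]; inversion h.
  - apply NEval_id, NEval_var in h; rewrite <- hl in h at 1; rewrite next_ge, hd in h.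
    unfold nargs in h; cbn in h; rewrite <- seq_shift, map_map in h.
    destruct (RelArgs_length _ _ _ _ ha) as [la la'].
    eapply (Rel_elim k s q _ c []); [apply hq, IH| |exact h].
    + rewrite <- la, next_ge; exact hd.
    + apply RelArgs_intro; rewrite ?length_map, ?length_seq; auto.
      intros j Hj; rewrite nth_map_seq by auto.
      apply Rel_eta; rewrite <- la, next_nth with (d := NG) by lia.
      now apply RelArgs_nth.
Qed.

(** The fixed point of [Q] becomes a recursive definition of a fresh name [f], whose body is the
    normal form of [Q] applied to [f]. Its level is that of [s], hence at most [k]. *)
Lemma Red_Y k G s rho : lv s <= k ->
  Red k (Arr (Arr s s) s) G (fun v => NC (den_Y s) (rho v)) (fun _ => []).
Proof.
  intros hs G1 Q hG1 hQ redQ; apply Red_intro; intros G' Qs hG' ha.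
  destruct (fresh_name G') as [f fr]; assert (sb := subctx_fresh G' f s fr).
  assert (lk : clookup ((f, s) :: G') f = Some s) by (cbn; now rewrite Nat.eqb_refl).
  assert (hQ' : loc G' Q) by (eapply loc_sub; eauto).
  destruct (reflect_reify k s) as (hrefl & hreif & hargs).
  destruct (hreif ((f, s) :: G') Q (fun v => [v f])) as (ps & F & e1 & e2 & e3).
  { eapply loc_sub; eauto. }
  { intros v v' e; now rewrite (e f s lk). }
  { apply (redQ ((f, s) :: G') (fun v => v f)); [eapply subctx_trans; eauto| |exact (hrefl _ _ lk)].
    intros v v' e; exact (e f s lk). }
  destruct (reify_args k ((f, s) :: G') (argtys s) Qs) as (pa & ba & e4 & e5 & e6); auto.
  { eapply RedArgs_sub; eauto. }
  exists (BRec f ps F (BVar f (length (argtys s)) pa ba)); split.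
  { econstructor; eauto; econstructor; eauto. }
  intros v c hv st res h; cbn [app] in h; apply (NCall_merge k (Arr s s) (Fsig s 0)) in h.
  set (a := NC (Fsig s 0) (ncons (Q v) (rho v))) in *.
  set (cr := Cl ps F (ERec f ps F c)).
  (* A run uses finitely many unfoldings, and [e3] lets the recursive closure simulate each of them,
     given a simulation of the previous one. *)
  assert (hr : Rel k s a [] cr []).
  { apply Rel_intro; intros l l' st' res' hl h'.
    apply NCall_unwind in h' as [m h'].
    eapply (Rel_elim k s _ [] cr []); [|exact hl|exact h'].
    apply Rel_FsigN with (Q v); auto; intros a0 ha0.
    specialize (e3 _ _ (RelCtx_rec _ _ _ _ _ _ _ _ _ fr hv ha0)).
    rewrite (loc_upd _ _ _ _ _ fr hQ') in e3.
    unfold upd in e3; rewrite Nat.eqb_refl in e3; exact e3. }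
  apply Eval_rec, Eval_var with cr; [cbn; now rewrite Nat.eqb_refl|].
  eapply (Rel_elim k s a [] cr []); [exact hr| |exact h].
  specialize (e6 _ _ (RelCtx_rec _ _ _ _ _ _ _ _ _ fr hv hr)).
  replace (map (fun Q0 => Q0 v) Qs) with (map (fun Q0 => Q0 (upd v f a)) Qs); auto.
  clear - ha fr; induction ha as [|? Q0 ? ? [h _] _ IH]; cbn; auto.
  f_equal; auto; eapply loc_upd; eauto.
Qed.

Lemma fundamental k D M s : has_type D M s -> Y_level_le k M ->
  forall G (Q : nat -> val -> nclo), (forall i, loc G (Q i)) ->
  (forall i t, nth_error D i = Some t -> Red k t G (Q i) (fun _ => [])) ->
  Red k s G (fun v => NC (den D M) (fun i => Q i v)) (fun _ => []).
Proof.
  induction 1 as [D i s h|D s t M h IH|D s t M M' h1 IH1 h2 IH2|D n|D|D|D|D s|D f];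
    cbn [Y_level_le]; intros hY G Q hl hQ.
  - eapply Red_src; [|exact (hQ i s h)].
    intros v a st res hc; cbn in *; rewrite (nth_error_nth _ _ _ h) in hc.
    now apply NCall_eta in hc.
  - intros G' Q' hG' hl' hQ'.
    eapply Red_src; [|apply (IH hY G' (fun i => match i with 0 => Q' | S i => Q i end))].
    + intros v a st res hc; cbn in *; apply NCall_merge in hc.
      replace (fun i => _) with (ncons (Q' v) (fun i => Q i v)); auto.
      apply functional_extensionality; now intros [|i].
    + intros [|i]; auto; eapply loc_sub; eauto.
    + intros [|i] t'; cbn; [intros [= <-]; auto|intros e; eapply Red_sub; eauto].
  - destruct hY as [hY1 hY2].
    eapply Red_src; [|apply (IH1 hY1 G Q hl hQ G (fun v => NC (den D M') (fun i => Q i v)))].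
    + intros v a st res hc; cbn in *.
      destruct (den_shape _ _ _ h1) as [e eq]; rewrite eq in *; now apply NCall_nsp_app.
    + apply subctx_refl.
    + intros v v' e; f_equal; apply functional_extensionality; intros i; now apply hl.
    + now apply IH2.
  - exists (BNum n); split; [constructor|]; intros v rho _ st res hc.
    apply NCall_clo in hc as [_ [m hc]]; inversion hc; subst; exists 1; constructor.
  - apply (Red_C k G (fun i => Some (S i))).
  - apply (Red_C k G (fun i => Some (i - 1))).
  - apply Red_ifz.
  - now apply Red_Y.
  - apply Red_C.
Qed.

(** * The opponent cannot be deceived *)

Lemma lv_pure n : lv (pure n) = n.
Proof. induction n as [|n IH]; cbn; auto; rewrite IH; lia. Qed.

Lemma lv_argtys s : Forall (fun t => lv t < lv s) (argtys s).
Proof.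
  induction s as [|s _ t IH]; cbn; constructor; [lia|].
  eapply Forall_impl; [|exact IH]; cbn; intros; lia.
Qed.

Lemma argtys_pure k : argtys (pure (S k)) = [pure k].
Proof. reflexivity. Qed.

Inductive side : Type := SL | SH.
Definition flip (d : side) : side := match d with SL => SH | SH => SL end.

(* While token [s] of round [r] is awaited, code is divided into the side [SH]
   that may contain this token and the side [SL] that may contain its intended
   argument, token [S s].  The sides share only closures of level less than
   [k - s] (from [SH] to [SL]) or less than [k - s - 1] (from [SL] to [SH]),
   so that neither can pass token [S s] itself to token [s]. *)
Definition tok_ok (d : side) (s r s' r' : nat) : Prop :=
  match d with
  | SL => r' <> r \/ (s' <= S s /\ s' <> s)
  | SH => r' <> r \/ s' <= s
  end.

Definition lim (k s : nat) (d : side) (t : ty) : Prop :=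
  match d with SL => lv t < k - s | SH => lv t + 1 < k - s end.

(** [CG] may occur on both sides, because a call of [g] during a test has no rule and so yields no
    result. A recursive definition brings no closure of its own into the environment; it is
    constrained by typing alone. *)
Inductive okc (k s r : nat) : side -> clo -> ty -> Prop :=
| ok_G d : okc k s r d CG (gty k)
| ok_tok d s' r' : tok_ok d s r s' r' -> s' <= k -> okc k s r d (CO s' r') (pure (k - s'))
| ok_cl d ps b rho G t : oke k s r d rho G -> map snd ps = argtys t ->
    wt k (extctx ps G) b -> okc k s r d (Cl ps b rho) t
with oke (k s r : nat) : side -> cenv -> ctx -> Prop :=
| oke_nil d : oke k s r d ENil []
| oke_same d x c t rho G : okc k s r d c t -> oke k s r d rho G ->
    oke k s r d (ECons x c rho) ((x, t) :: G)
| oke_flip d x c t rho G : lim k s d t -> okc k s r (flip d) c t -> oke k s r d rho G ->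
    oke k s r d (ECons x c rho) ((x, t) :: G)
| oke_rec d f ps F t rho G : map snd ps = argtys t -> wt k (extctx ps ((f, t) :: G)) F ->
    oke k s r d rho G -> oke k s r d (ERec f ps F rho) ((f, t) :: G).

Scheme okc_mind := Minimality for okc Sort Prop
with oke_mind := Minimality for oke Sort Prop.
Combined Scheme ok_mutind from okc_mind, oke_mind.

Definition oka k s r d c t := okc k s r d c t \/ (lim k s d t /\ okc k s r (flip d) c t).

Lemma oke_lookup k s r d rho G : oke k s r d rho G -> forall x t, clookup G x = Some t ->
  exists c, lookup rho x = Some c /\ oka k s r d c t.
Proof.
  unfold oka; induction 1; cbn; intros y u h; [discriminate|..];
    destruct (Nat.eqb_spec y x) || destruct (Nat.eqb_spec y f); subst; eauto;
    injection h as <-; eexists; split; eauto.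
  left; econstructor; eauto; now constructor.
Qed.

Lemma oke_ext k s r d : forall ps args rho G, oke k s r d rho G ->
  Forall2 (oka k s r d) args (map snd ps) -> oke k s r d (extenv ps args rho) (extctx ps G).
Proof.
  induction ps as [|[x t] ps IH]; intros args rho G h ha; cbn in *; auto.
  inversion ha as [|c ? ? ? hc ha']; subst; apply IH; auto.
  destruct hc as [hc|[hl hc]]; [now constructor|now apply oke_flip].
Qed.

(** Tokens numbered up to [S s] are what [SH] tolerates at the next stage, so both old sides may be
    merged into it. *)
Lemma ok_shift_H k s r :
  (forall d c t, okc k s r d c t -> okc k (S s) r SH c t) /\
  (forall d rho G, oke k s r d rho G -> oke k (S s) r SH rho G).
Proof.
  apply ok_mutind; intros; try (econstructor; eauto; fail).
  constructor; auto; destruct d; cbn in *; lia.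
Qed.

(** The old [SH] is free of token [S s] and thus qualifies as the new [SL]. The closures it borrowed
    from [SL] now count as [SH], and the two limits agree: [lv t + 1 < k - s] is
    [lv t < k - S s]. *)
Lemma ok_shift_L k s r :
  (forall d c t, okc k s r d c t -> d = SH -> okc k (S s) r SL c t) /\
  (forall d rho G, oke k s r d rho G -> d = SH -> oke k (S s) r SL rho G).
Proof.
  apply ok_mutind; intros; subst; try (econstructor; eauto; fail).
  - constructor; auto; cbn in *; lia.
  - apply oke_flip; auto; [cbn in *; lia|].
    cbn in *; eapply (proj1 (ok_shift_H k s r)); eauto.
Qed.

Lemma flip_flip d : flip (flip d) = d.
Proof. now destruct d. Qed.

Lemma cargs_Forall2 (P : clo -> ty -> Prop) ss ps bs rho :
  (forall j, j < length ss -> P (Cl (ps j) (bs j) rho) (nth j ss N)) ->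
  Forall2 P (cargs (length ss) ps bs rho) ss.
Proof.
  revert ps bs; induction ss as [|t ss IH]; intros ps bs h; [constructor|].
  unfold cargs; cbn; rewrite <- seq_shift, map_map; constructor.
  - apply (h 0); cbn; lia.
  - apply (IH (fun j => ps (S j)) (fun j => bs (S j))); intros j Hj; apply (h (S j)); cbn; lia.
Qed.

(** Code on [SL] lacks the awaited token and can reach it only through closures on [SH]. If token
    [s] is called on [SH], its argument has level [k - s - 1], which is too high to come from [SL];
    so it lies on [SH], does not know token [S s], and fails the next test by induction. *)
Lemma test_fails k r : forall n s d, s <= k -> (d = SH -> s < k) ->
  (forall b rho G, oke k s r d rho G -> wt k G b -> ~ eval k n b rho (Test r s) ROk) /\
  (forall c t args, okc k s r d c t -> Forall2 (oka k s r d) args (argtys t) ->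
     ~ call k n c args (Test r s) ROk).
Proof.
  induction n as [|n IH]; intros s d hs hd; (split; [intros b rho G hr hw ev|
    intros c t args hc ha ev]); try (now inversion ev).
  - destruct (IH s d hs hd) as [IHe IHc].
    inversion ev as [| |? f b0 ? ? ? e1|? b0 b1 b2 ? ? m ? e1 e2|? b0 b1 b2 ? ? ? e1 _
                    |? x r0 ps bs ? ? ? c lk e1|? f ps F b0 ? ? ? e1]; subst;
      inversion hw as [|? ? ? w1|? ? ? ? w1 w2 w3|? ? t ? ? ? l1 l2 w1 w2|? ? t ? ? ? l1 w1 w2 w3]; subst.
    + eapply IHe; eauto.
    + destruct m; (eapply IHe; [exact hr| |exact e2]; auto).
    + eapply IHe; [exact hr|exact w1|exact e1].
    + destruct (oke_lookup _ _ _ _ _ _ hr _ _ l1) as (c' & lk' & hc).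
      rewrite lk in lk'; injection lk' as <-.
      assert (hb : forall j, j < length (argtys t) ->
                okc k s r d (Cl (ps j) (bs j) rho) (nth j (argtys t) N))
        by (intros; econstructor; eauto).
      destruct hc as [hc|[hl hc]].
      * eapply IHc; eauto; apply cargs_Forall2; intros; left; auto.
      * assert (hs' : s < k) by (destruct d; cbn in hl; lia).
        destruct (IH s (flip d) hs) as [_ IHc']; auto.
        (* The call crosses to the other side and takes the arguments along as borrowed closures.
           Argument levels drop by at least one, which is the gap between the two limits. *)
        eapply IHc'; eauto; apply cargs_Forall2; intros j Hj; right; rewrite flip_flip.
        split; auto.
        pose proof (lv_argtys t) as hlv; rewrite Forall_forall in hlv.
        specialize (hlv _ (nth_In _ N Hj)); destruct d; cbn in *; lia.
    + eapply IHe; [|exact w3|exact e1]; now constructor.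
  - inversion ev as [? ps b rho ? ? ? hl e1| | |? s0 r0 W hs' e1|]; subst.
    + destruct (IH s d hs hd) as [IHe IHc].
      inversion hc as [| |? ? ? ? G ? hr hm hw]; subst.
      eapply IHe; [|exact hw|exact e1].
      apply oke_ext; auto; now rewrite hm.
    + inversion hc as [|? ? ? htok _|]; subst.
      destruct d; cbn in htok; [lia|].
      destruct (k - s) as [|j] eqn:ej; [lia|].
      rewrite argtys_pure in ha; inversion ha as [|? ? ? ? hW _]; subst.
      (* A borrowed argument would violate the limit of [SH], since its level is exactly
         [k - s - 1]. *)
      destruct hW as [hW|[hW _]]; [|cbn in hW; rewrite lv_pure in hW; lia].
      destruct (IH (S s) SL) as [_ IHc]; [lia|discriminate|].
      eapply IHc; [eapply (proj1 (ok_shift_L k s r)); eauto| |exact e1].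
      unfold ctok; destruct (Nat.leb_spec (S (S s)) k).
      * replace j with (S (k - S (S s))) by lia; rewrite argtys_pure.
        constructor; [|constructor]; left; constructor; auto; cbn; lia.
      * replace j with 0 by lia; constructor.
    + inversion hc as [|? ? ? htok _|]; subst; destruct d; cbn in htok; [lia|].
      specialize (hd eq_refl); lia.
Qed.

(** * Winning needs nested scopes *)

Fixpoint size (b : body) : nat :=
  match b with
  | BNum _ => 1
  | BC _ b => S (size b)
  | BIfz b b1 b2 => S (size b + size b1 + size b2)
  | BVar _ r _ bs => S (list_sum (map (fun j => size (bs j)) (seq 0 r)))
  | BRec _ _ F b => S (size F + size b)
  end.

Lemma size_arg x r ps bs j : j < r -> size (bs j) < size (BVar x r ps bs).
Proof.
  intros h; cbn; unfold list_sum; apply Nat.lt_succ_r.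
  assert (hj : In j (seq 0 r)) by (apply in_seq; lia).
  induction (seq 0 r) as [|i l IH]; cbn in *; [easy|].
  destruct hj as [->|hj]; [lia|specialize (IH hj); lia].
Qed.

(** Lexical scope: only the bindings of the environment itself count, not those inside captured
    closures. *)
Fixpoint direct (r : nat) (rho : cenv) : Prop :=
  match rho with
  | ENil => False
  | ECons _ c rho => c = CO 0 r \/ direct r rho
  | ERec _ _ _ rho => direct r rho
  end.

(* The invariant of the rounds: the only variables of level [k] are bound to
   tokens or recursive definitions, and the code in whose scope the current
   token [CO 0 r] lies has size at most [m]. *)
Inductive gdc (k r m : nat) : clo -> ty -> Prop :=
| gd_G : gdc k r m CG (gty k)
| gd_tok s' r' : r < r' \/ (r' = r /\ s' = 0) -> s' <= k -> gdc k r m (CO s' r') (pure (k - s'))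
| gd_cl ps b rho G t : gde k r m rho G -> map snd ps = argtys t ->
    wt k (extctx ps G) b -> (direct r rho -> size b <= m) -> gdc k r m (Cl ps b rho) t
with gde (k r m : nat) : cenv -> ctx -> Prop :=
| gde_nil : gde k r m ENil []
| gde_cons x c t rho G : gdc k r m c t -> lv t < k \/ c = CG \/ (exists r', c = CO 0 r') ->
    gde k r m rho G -> gde k r m (ECons x c rho) ((x, t) :: G)
| gde_rec f ps F t rho G : lv t <= k -> map snd ps = argtys t ->
    wt k (extctx ps ((f, t) :: G)) F -> (direct r rho -> size F <= m) ->
    gde k r m rho G -> gde k r m (ERec f ps F rho) ((f, t) :: G).

Scheme gdc_mind := Minimality for gdc Sort Prop
with gde_mind := Minimality for gde Sort Prop.
Combined Scheme gd_mutind from gdc_mind, gde_mind.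

Lemma gd_ok k r m :
  (forall c t, gdc k r m c t -> okc k 0 r SH c t) /\
  (forall rho G, gde k r m rho G -> oke k 0 r SH rho G).
Proof.
  apply gd_mutind; intros; try (econstructor; eauto; fail).
  constructor; auto; cbn; lia.
Qed.

(** The link between scoping and the test. If the current token is not bound directly, every
    occurrence of it is hidden in a closure of level less than [k], which is just what [SL] may
    borrow from [SH]. *)
Lemma gde_ok_L k r m rho G : gde k r m rho G -> ~ direct r rho -> oke k 0 r SL rho G.
Proof.
  induction 1 as [|x c t rho G hc hl hr IH|f ps F t rho G h1 h2 h3 h4 hr IH]; cbn; intros nd.
  - constructor.
  - destruct hl as [hl|[->|[r' ->]]].
    + apply oke_flip; auto; [cbn; lia|]; now apply (proj1 (gd_ok k r m)).
    + inversion hc; subst; constructor; auto; constructor.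
    + inversion hc; subst; constructor; auto; constructor; auto.
      left; intros ->; auto.
  - constructor; auto.
Qed.

Lemma gde_old k r m rho G r0 : r0 < r -> gde k r m rho G -> ~ direct r0 rho.
Proof.
  intros h; induction 1 as [|x c t rho G hc hl hr IH|]; cbn; auto.
  intros [->|h']; auto; inversion hc; lia.
Qed.

(** Round numbers decrease, so a token of a later round occurs nowhere in older data. Its scope is
    still empty, and the size bound can be reset to any [m']. *)
Lemma gd_next k r m r0 m' : r0 < r ->
  (forall c t, gdc k r m c t -> gdc k r0 m' c t) /\
  (forall rho G, gde k r m rho G -> gde k r0 m' rho G).
Proof.
  intros h; apply gd_mutind; intros; try (econstructor; eauto; fail).
  - constructor; auto; lia.
  - econstructor; eauto; intros; exfalso; eapply gde_old; eauto.
  - econstructor; eauto; intros; exfalso; eapply gde_old; eauto.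
Qed.

Lemma gde_lookup k r m rho G : gde k r m rho G -> forall x t, clookup G x = Some t ->
  exists c, lookup rho x = Some c /\ gdc k r m c t /\
    forall ps b rho', c = Cl ps b rho' -> lv t <= k.
Proof.
  induction 1 as [|x c t rho G hc hl hr IH|f ps F t rho G h1 h2 h3 h4 hr IH]; cbn;
    intros y u h; [discriminate|..].
  - destruct (Nat.eqb_spec y x); auto; injection h as <-; eexists; repeat split; auto.
    intros ps b rho' ->; destruct hl as [hl|[hl|[r' hl]]]; try discriminate; lia.
  - destruct (Nat.eqb_spec y f); auto; injection h as <-; eexists; repeat split; auto.
    econstructor; eauto; now constructor.
Qed.

(** Arguments of level less than [k] cannot be the current token, whose level is [k]; binding them
    leaves its lexical scope as it was. *)
Lemma gde_ext k r m : forall ps args rho G, gde k r m rho G ->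
  Forall2 (fun c t => gdc k r m c t /\ lv t < k) args (map snd ps) ->
  gde k r m (extenv ps args rho) (extctx ps G) /\
  (direct r (extenv ps args rho) -> direct r rho).
Proof.
  induction ps as [|[x t] ps IH]; intros args rho G h ha; cbn in *; auto.
  inversion ha as [|c ? ? ? [hc hl] ha']; subst.
  destruct (IH l (ECons x c rho) ((x, t) :: G)) as [h1 h2]; auto; [now constructor; auto|].
  split; auto; intros h3; destruct (h2 h3) as [->|h4]; auto.
  inversion hc; subst; rewrite Nat.sub_0_r, lv_pure in hl; lia.
Qed.

(* A token [CO 0 r] that passes the test of a call of [g] is bound in the scope
   of that call, hence the continuation [F] of the call is a proper part of the
   code in the scope of [CO 0 r]. *)
Lemma win_fails k : 1 <= k -> forall n r m, m < r ->
  (forall b rho G, gde k r m rho G -> wt k G b -> (direct r rho -> size b <= m) ->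
     ~ eval k n b rho (Idle r) RWin) /\
  (forall ps b rho t args, gdc k r m (Cl ps b rho) t -> lv t <= k ->
     Forall2 (gdc k r m) args (argtys t) -> ~ call k n (Cl ps b rho) args (Idle r) RWin).
Proof.
  intros hk; induction n as [n IH] using lt_wf_ind; intros r m hm; split.
  - intros b rho G hr hw hsz ev.
    inversion ev as [| |n0 f b0 ? ? ? e1|n0 b0 b1 b2 ? ? i ? e1 e2|n0 b0 b1 b2 ? ? ? e1 _
                    |n0 x r0 ps bs ? ? ? c lk e1|n0 f ps F b0 ? ? ? e1]; subst;
      inversion hw as [|? ? ? w1|? ? ? ? w1 w2 w3|? ? t ? ? ? l1 l2 w1 w2|? ? t ? ? ? l1 w1 w2 w3];
      subst; destruct (IH n0 (Nat.lt_succ_diag_r _) r m hm) as [IHe IHc].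
    + eapply IHe; eauto; intros d; specialize (hsz d); cbn in hsz; lia.
    + destruct i; (eapply IHe; [exact hr| | |exact e2]; auto);
        intros d; specialize (hsz d); cbn in hsz; lia.
    + eapply IHe; [exact hr|exact w1| |exact e1].
      intros d; specialize (hsz d); cbn in hsz; lia.
    + destruct (gde_lookup _ _ _ _ _ hr _ _ l1) as (c' & lk' & hc & hl).
      rewrite lk in lk'; injection lk' as <-.
      destruct c as [ps' b' rho'| |s' r'].
      * eapply IHc; eauto; apply cargs_Forall2; intros j Hj; econstructor; eauto.
        intros d; specialize (hsz d); pose proof (size_arg x _ ps bs j Hj); lia.
      * inversion hc; subst; cbn [gty argtys pure length cargs map seq] in *.
        inversion e1 as [|?|n1 F e r0 h1 h2| |]; subst; [lia|].
        (* Otherwise the environment of [e] lies on [SL], where the probe [CO 1 (S r0)] is also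
           permitted, and the test could not have succeeded. *)
        assert (dr : direct (S r0) rho).
        { apply NNPP; intros nd.
          destruct (test_fails k (S r0) n1 0 SL) as [_ T]; [lia|discriminate|].
          eapply (T (Cl (ps 1) (bs 1) rho) (pure k)); [| |exact h1].
          - econstructor; [eapply gde_ok_L; eauto|apply (w1 1); lia|apply w2; lia].
          - destruct k as [|k]; [lia|]; rewrite argtys_pure; constructor; [|constructor].
            left; replace (pure k) with (pure (S k - 1)) by (f_equal; lia).
            constructor; [cbn; lia|lia]. }
        assert (w10 := w1 0 Nat.lt_0_2); assert (w20 := w2 0 Nat.lt_0_2); cbn in w10.
        destruct (ps 0) as [|[y u] [|? ?]] eqn:ep; try discriminate; injection w10 as ->.
        (* [F] has level [k + 1], beyond the second half of the statement, so its call is unfolded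
           here. Its parameter becomes the token of round [r0], and the new bound is the size of its
           code, which is smaller than [m] and hence smaller than [r0]. *)
        inversion h2 as [n2 ? ? ? ? ? ? _ h3| | | |]; subst; cbn in h3.
        specialize (hsz dr); pose proof (size_arg x 2 ps bs 0 Nat.lt_0_2).
        destruct (IH n2) with (r := r0) (m := size (bs 0)) as [IHe' _]; [lia|lia|].
        eapply IHe'; [|exact w20| |exact h3]; [|lia].
        constructor.
        -- rewrite <- (Nat.sub_0_r k) at 2; constructor; auto; lia.
        -- eauto.
        -- eapply (proj2 (gd_next k (S r0) m r0 _ (Nat.lt_succ_diag_r _))); eauto.
      * inversion e1.
    + eapply IHe; [|exact w3| |exact e1]; [constructor; auto|];
        intros d; cbn in *; specialize (hsz d); lia.
  - intros ps b rho t args hc hl ha ev; inversion ev as [n0 ? ? ? ? ? ? _ e1| | | |]; subst.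
    destruct (IH n0 (Nat.lt_succ_diag_r _) r m hm) as [IHe _].
    inversion hc as [| |? ? ? G ? hr hm' hw hsz]; subst.
    destruct (gde_ext k r m ps args rho G) as [h1 h2]; auto.
    + rewrite hm'; pose proof (lv_argtys t) as hlv.
      revert hlv; clear - ha hl; induction ha; intros hlv; inversion hlv; subst; constructor; auto.
      split; auto; lia.
    + eapply IHe; eauto.
Qed.

Lemma no_winning_body k b g x : 1 <= k -> wt k [(x, pure k); (g, gty k)] b ->
  exists r, ~ Eval k b (ECons x (CO 0 r) (ECons g CG ENil)) (Idle r) RWin.
Proof.
  (* The whole body lies in the scope of the first token, so its size is the initial bound and one
     more round already exceeds it. *)
  intros hk hw; exists (S (size b)); intros [n ev].
  destruct (win_fails k hk n (S (size b)) (size b)) as [h _]; auto.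
  eapply h; eauto.
  constructor; eauto; [|constructor; eauto; constructor].
  - rewrite <- (Nat.sub_0_r k) at 2; constructor; auto; lia.
Qed.

(** * Fixed points win *)

(** Each unfolding of the fixed point passes on the eta-expansion of its argument, and running that
    expansion eta-expands the probes as well, so iterated expansions have to be accepted at every
    level. *)
Inductive like (k s r : nat) : nclo -> Prop :=
| lk_tok : like k s r (NO s r)
| lk_eta x rho : like k s r (rho x) -> like k s r (NC (eta (pure (k - s)) x) rho).

Lemma like_test k r : forall j s c, k - s = j -> s <= k -> like k s r c ->
  forall a, (if s <? k then exists w, a = [w] /\ like k (S s) r w else a = []) ->
  NCall k c a (Test r s) ROk.
Proof.
  induction j as [j IH] using lt_wf_ind; intros s c ej hs hc.
  induction hc as [|x rho hc IHc]; intros a ha.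
  - destruct (Nat.ltb_spec s k).
    + destruct ha as (w & -> & hw); apply NCall_O; auto.
      eapply (IH (k - S s)); eauto; try lia.
      unfold ntok; destruct (Nat.leb_spec (S (S s)) k), (Nat.ltb_spec (S s) k); try lia; auto.
      eexists; split; eauto; constructor.
    + subst a; replace s with k by lia; exists 1; constructor.
  - rewrite etaE; apply NCall_clo.
    destruct (Nat.ltb_spec s k).
    + destruct ha as (w & -> & hw); destruct (k - s) as [|j'] eqn:ej'; [lia|].
      split; auto; apply NEval_id, NEval_var; cbn; rewrite Nat.add_1_r; apply IHc.
      eexists; split; eauto; replace j' with (k - S s) by lia; now constructor.
    + subst a; replace (k - s) with 0 in * by lia; split; auto.
      apply NEval_id, NEval_var; cbn; rewrite Nat.add_0_r; now apply IHc.
Qed.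

Lemma like_pass k r c : 1 <= k -> like k 0 r c -> NCall k c [NO 1 r] (Test r 0) ROk.
Proof.
  intros hk hc; eapply like_test; eauto; [lia|].
  destruct k; [lia|]; cbn; eexists; split; eauto; constructor.
Qed.

Lemma like_eta k r x rho : like k 0 r (rho x) -> like k 0 r (NC (eta (pure k) x) rho).
Proof. intros h; rewrite <- (Nat.sub_0_r k) at 2; now constructor. Qed.

Lemma NCall_G k r F e : 1 <= k -> like k 0 r e ->
  (forall r', r = S r' -> NCall k F [NO 0 r'] (Idle r') RWin) ->
  NCall k NG [F; e] (Idle r) RWin.
Proof.
  intros hk he hF; destruct r as [|r]; [exists 1; constructor|].
  apply NCall_GS; auto; now apply like_pass.
Qed.

Lemma NCall_merge_back k s p rho a args st res :
  NCall k (NC p (ncons a rho)) args st res ->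
  NCall k (NC (lam_merge s p) rho) (a :: args) st res.
Proof.
  destruct p as [ts e]; cbn; intros h; apply NCall_clo in h as [hl h]; apply NCall_clo.
  split; [cbn; congruence|exact h].
Qed.

Lemma win_Fsig k : 1 <= k -> forall r d rho c, rho d = NG -> like k 0 r c ->
  NCall k (NC (Fsig (pure (S k)) d) rho) [c] (Idle r) RWin.
Proof.
  intros hk; induction r as [|r IH]; intros d rho c hd hc; rewrite FsigE;
    apply NCall_clo; split; auto; apply NEval_id, NEval_var; cbn;
    rewrite Nat.add_1_r; cbn; rewrite hd; apply NCall_G; auto.
  - now apply like_eta.
  - discriminate.
  - now apply like_eta.
  - intros r' [= <-]; apply IH; cbn; auto; constructor.
Qed.

(* [fun f n x => g (fun x' => f 0 x') x], with [g] free: its fixed point at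
   type [N -> pure (S k)], applied to [0], behaves as that of [g]. *)
Definition lift_g (k : nat) : mproc :=
  MLam [Arr N (pure (S k)); N; pure k]
    (MCase (MVar 3 2 (fun j => match j with
       | 0 => MLam [pure k]
           (MCase (MVar 3 2 (fun j => match j with
              | 0 => MLam [] (MNum 0)
              | S _ => eta (pure k) 0
              end)) MNum)
       | S _ => eta (pure k) 0
       end)) MNum).

Lemma win_Fsig_lift k : 1 <= k -> forall r d rho z c,
  rho d = NC (lift_g k) (fun _ => NG) -> like k 0 r c ->
  NCall k (NC (Fsig (Arr N (pure (S k))) d) rho) [z; c] (Idle r) RWin.
Proof.
  intros hk; induction r as [|r IH]; intros d rho z c hd hc; rewrite FsigE;
    apply NCall_clo; (split; [reflexivity|]); apply NEval_id, NEval_var; cbn;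
    replace (d + 2) with (S (S d)) by lia; cbn; rewrite hd;
    apply NCall_clo; (split; [reflexivity|]); apply NEval_id, NEval_var; cbn;
    apply NCall_G; auto; try (now apply like_eta, like_eta); try discriminate.
  intros r' [= <-]; apply NCall_clo; split; [reflexivity|].
  apply NEval_id, NEval_var; cbn; apply IH; auto.
  apply like_eta; constructor.
Qed.

Lemma Red_zero k G rho : Red k N G (fun v => NC (MLam [] (MNum 0)) (rho v)) (fun _ => []).
Proof.
  exists (BNum 0); split; [constructor|]; intros v c _ st res h.
  apply NCall_clo in h as [_ [n h]]; inversion h; subst; exists 1; constructor.
Qed.

(** [lift_g] is a bare procedure with [g] free rather than the denotation of a term, so its
    reducibility is established directly instead of through [fundamental]. *)
Lemma Red_lift_g k G g : clookup G g = Some (gty k) ->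
  Red k (Arr (Arr N (pure (S k))) (Arr N (pure (S k)))) G
    (fun v => NC (lift_g k) (fun _ => v g)) (fun _ => []).
Proof.
  intros hg; apply Red_intro; intros G' Qs hG ha; cbn [argtys pure] in ha.
  inversion ha as [|? Qf ? ? [lf rf] ha1]; subst.
  inversion ha1 as [|? Qn ? ? [ln rn] ha2]; subst.
  inversion ha2 as [|? Qx ? ? [lx rx] ha3]; subst; inversion ha3; subst.
  destruct (fresh_name G') as [x fr]; assert (sb := subctx_fresh G' x (pure k) fr).
  assert (lkx : clookup ((x, pure k) :: G') x = Some (pure k))
    by (cbn; now rewrite Nat.eqb_refl).
  (* The closure of the numeral 0 in exactly the environment that running [lift_g] builds around it,
     which therefore mentions [Qf], [Qn], [Qx] and the two names. *)
  set (ze := fun v : val => NC (MLam [] (MNum 0))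
               (next [v x] (next [Qf v; Qn v; Qx v] (fun _ => v g)))).
  assert (lz : loc ((x, pure k) :: G') ze).
  { intros v v' e; unfold ze.
    rewrite (loc_sub _ _ _ sb lf v v' e), (loc_sub _ _ _ sb ln v v' e),
      (loc_sub _ _ _ sb lx v v' e), (e x _ lkx), (e g (gty k)); auto. }
  assert (hF : RedN k ((x, pure k) :: G') Qf (fun v => [ze v; v x])).
  { apply (rf ((x, pure k) :: G') ze) with (Q := fun v => v x); auto.
    - apply Red_zero.
    - apply subctx_refl.
    - intros v v' e; exact (e _ _ lkx).
    - now apply (proj1 (reflect_reify k (pure k))). }
  destruct hF as (bF & wF & HF).
  destruct (reflect_reify k (pure k)) as (_ & reif & _).
  destruct (reif G' Qx (fun _ => [])) as (pe & be & e1 & e2 & e3); auto.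
  { now intros v v'. }
  exists (BVar g 2 (fun j => match j with 0 => [(x, pure k)] | S _ => pe end)
                   (fun j => match j with 0 => bF | S _ => be end)); split.
  { apply wt_var with (gty k); auto; intros [|[|j]] Hj; auto; lia. }
  intros v rho hv st res h; cbn in h.
  apply NCall_clo in h as [_ h]; apply NEval_id, NEval_var in h; cbn in h.
  destruct (hv g (gty k)) as (c & lk & hc); auto; apply Eval_var with c; auto.
  eapply (Rel_elim k (gty k) (v g) [] c []); [exact hc| |exact h].
  constructor; [|constructor; [|constructor]].
  - apply Rel_intro; intros a a' st' res' hargs h'; cbn [argtys pure] in hargs.
    inversion hargs as [|? ? w ? w' ? hw hn]; subst; inversion hn; subst.
    apply Call_clo; auto; cbn.
    apply (HF (upd v x w)); [now apply RelCtx_cons|].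
    unfold ze; rewrite (loc_upd _ _ _ _ _ fr lf), (loc_upd _ _ _ _ _ fr ln),
      (loc_upd _ _ _ _ _ fr lx).
    replace (upd v x w x) with w by (unfold upd; now rewrite Nat.eqb_refl).
    replace (upd v x w g) with (v g).
    2:{ unfold upd; destruct (Nat.eqb_spec g x); auto; subst; apply hG in hg; congruence. }
    cbn in h'; apply NCall_clo in h' as [_ h']; apply NEval_id, NEval_var in h'; cbn in h'.
    (* The code hands on eta-expansions where [HF] expects the closures themselves; [sim_val]
       removes them. *)
    destruct h' as [n h']; eapply (sim_val_sound k n); [| |exact h'].
    + apply sim_val_refl.
    + constructor; [apply sim_val_refl|constructor; [|constructor]].
      apply sv_eta, sim_val_refl.
  - apply Rel_eta; cbn; auto.
Qed.

Lemma no_winning_Red k c l : 1 <= k -> RedN k [(0, pure k); (1, gty k)] c l ->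
  exists r, ~ NCall k (c (ncons (NO 0 r) (fun _ => NG))) (l (ncons (NO 0 r) (fun _ => NG)))
              (Idle r) RWin.
Proof.
  intros hk (b & hb & H); destruct (no_winning_body k b 1 0 hk hb) as [r nw].
  exists r; intros h; apply nw; eapply H; [|exact h].
  intros [|[|x]] s [= <-]; eexists; split; try reflexivity.
  - pose proof (Rel_tok k r 0) as ht; rewrite Nat.sub_0_r in ht; apply ht; lia.
  - now apply Rel_G.
Qed.

Theorem theorem2p11 : forall k : nat, 1 <= k ->
  ~ PCFk_denotable k (Arr (Arr (pure (S k)) (pure (S k))) (pure (S k)))
      (den_Y (pure (S k))) /\
  ~ PCFk_denotable k
      (Arr (Arr (Arr N (pure (S k))) (Arr N (pure (S k)))) (Arr N (pure (S k))))
      (den_Y (Arr N (pure (S k)))).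
Proof.
  intros k hk.
  set (G := [(0, pure k); (1, gty k)]).
  assert (var : forall x s, clookup G x = Some s ->
    loc G (fun v => v x) /\ Red k s G (fun v => v x) (fun _ => [])).
  { intros x s e; split; [intros v v' h; eauto|].
    now apply (proj1 (reflect_reify k s)). }
  destruct (var 0 (pure k) eq_refl) as [l0 r0], (var 1 (gty k) eq_refl) as [l1 r1].
  assert (fund : forall M s, closed_PCFk k M s ->
    Red k s G (fun _ => NC (den [] M) (fun _ => NG)) (fun _ => [])).
  { intros M s [ht hY]; apply (fundamental k [] M s ht hY G (fun _ _ => NG)).
    - now intros i v v'.
    - intros [|i]; discriminate. }
  split; intros (M & hM & eq); specialize (fund _ _ hM).
  (* The denotation applied to the names of [g] and [x] has a single normal form, whereas the fixed
     point wins for every number of rounds. *)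
  - assert (h := fund G (fun v => v 1) (subctx_refl G) l1 r1
                   G (fun v => v 0) (subctx_refl G) l0 r0).
    apply no_winning_Red in h as [r nw]; auto; apply nw; cbn [app].
    eapply NCall_nsp_eq; [exact eq|].
    apply NCall_merge_back, win_Fsig; auto; constructor.
  - assert (lH : loc G (fun v => NC (lift_g k) (fun _ => v 1))).
    { intros v v' e; now rewrite (e 1 (gty k) eq_refl). }
    assert (h := fund G _ (subctx_refl G) lH (Red_lift_g k G 1 eq_refl)
                   G (fun _ => NC (MLam [] (MNum 0)) (fun _ => NG)) (subctx_refl G)
                   (fun _ _ _ => eq_refl) (Red_zero k G _)
                   G (fun v => v 0) (subctx_refl G) l0 r0).
    apply no_winning_Red in h as [r nw]; auto; apply nw; cbn [app].
    eapply NCall_nsp_eq; [exact eq|].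
    apply NCall_merge_back, win_Fsig_lift; auto; constructor.
Qed.
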